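(* Let $M$ be an oriented closed connected manifold with fundamental group $\Gamma$, and let $\alpha=\Gamma\curvearrowright(X,\mu)$ and $\beta=\Gamma\curvearrowright(Y,\nu)$ be free non-atomic standard $\Gamma$-spaces such that $\alpha\prec\beta$ (i.e., $\alpha$ is weakly contained in $\beta$). Then $$\boldsymbol{|}M\boldsymbol{|}^{\beta}\le \boldsymbol{|}M\boldsymbol{|}^{\alpha}.$$
   Context: Let $\Gamma$ be a countable group. A standard $\Gamma$-space $\alpha=\Gamma\curvearrowright(X,\mu)$ is a standard Borel probability space $(X,\mu)$ (a Polish space with its Borel $\sigma$-algebra, up to isomorphism, with a probability measure) together with a measurable $\mu$-preserving left $\Gamma$-action; the action of $g\in\Gamma$ is denoted $g^\alpha$. It is called free if the action is free on a subset of full measure (essentially free). Weak containment: $\alpha=\Gamma\curvearrowright(X,\mu)$ is weakly contained in $\beta=\Gamma\curvearrowright(Y,\nu)$, written $\alpha\prec\beta$, if for all $\varepsilon>0$, all finite $F\subset\Gamma$, all $m\in\mathbb N$ and all Borel sets $A_1,\dots,A_m\subset X$ there exist Borel sets $B_1,\dots,B_m\subset Y$ with $|\mu(\gamma^\alpha(A_j)\cap A_k)-\nu(\gamma^\beta(B_j)\cap B_k)|<\varepsilon$ for all $\gamma\in F$ and $j,k\in\{1,\dots,m\}$. Parametrized simplicial volume: let $M$ be an oriented closed connected $n$-manifold with fundamental group $\Gamma$ and universal covering $\pi:\widetilde M\to M$, and let $\alpha=\Gamma\curvearrowright(X,\mu)$ be a standard $\Gamma$-space. Equip $L^\infty(X,\mu,\mathbb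 Z)$ (essentially bounded measurable $\mathbb Z$-valued functions modulo a.e. equality) with the right $\Gamma$-action $(f\cdot g)(x)=f(g^\alpha(x))$, and set $C_*(M;\alpha)=L^\infty(X,\mu,\mathbb Z)\otimes_{\mathbb Z\Gamma}C_*(\widetilde M;\mathbb Z)$ (singular chains, $\Gamma$ acting by deck transformations). The inclusion of $\mathbb Z$ as constant functions induces a chain map $C_*(M;\mathbb Z)\cong\mathbb Z\otimes_{\mathbb Z\Gamma}C_*(\widetilde M;\mathbb Z)\to C_*(M;\alpha)$. The image of the integral fundamental class $[M]_{\mathbb Z}$ in $H_n(C_*(M;\alpha))$ is the $\alpha$-parametrized fundamental class, and cycles representing it are $\alpha$-parametrized fundamental cycles. For a chain $c=\sum_{j=1}^k f_j\otimes\sigma_j$ in reduced form (i.e. $\pi\circ\sigma_j\ne\pi\circ\sigma_l$ for $j\neq l$) put $\boldsymbol{|}c\boldsymbol{|}^\alpha=\sum_{j=1}^k\int_X|f_j|\,d\mu$. Then $\boldsymbol{|}M\boldsymbol{|}^\alpha$ is the infimum of $\boldsymbol{|}c\boldsymbol{|}^\alpha$ over all $\alpha$-parametrized fundamental cycles $c$ of $M$. *)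

(* Defs.v *)
From HB Require Import structures.
From mathcomp Require Import freeg.
From mathcomp Require Import all_boot all_order all_algebra.
From mathcomp Require Import all_classical all_reals all_analysis.
From mathcomp Require Import ring_quotient generic_quotient.
Set Implicit Arguments.
Unset Strict Implicit.
Unset Printing Implicit Defensive.
Import Order.TTheory GRing.Theory Num.Theory numFieldNormedType.Exports.
Local Open Scope classical_set_scope.
Local Open Scope ring_scope.
Local Open Scope quotient_scope.

Section FreeAbelian.
Context (K : choiceType) (V : zmodType) (f : K -> V).

(* the Z-linear extension of [f] *)
Definition fgext (D : {freeg K / int}) : V :=
  \sum_(x <- dom D) f x *~ coeff x D.

Lemma fgext_sub (D : {freeg K / int}) (s : seq K) :
  uniq s -> {subset dom D <= s} -> fgext D = \sum_(x <- s) f x *~ coeff x D.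
Proof.
move=> us sub; rewrite [RHS](bigID (fun x => x \in dom D)) /=.
rewrite [X in _ + X]big1 ?addr0; last first.
  by move=> x xD; rewrite coeff_outdom.
rewrite /fgext -[RHS]big_filter; apply: perm_big; apply: uniq_perm.
- exact: uniq_dom.
- exact: filter_uniq.
- by move=> x; rewrite mem_filter andb_idr //; exact: sub.
Qed.

Lemma fgextB (D E : {freeg K / int}) : fgext (D - E) = fgext D - fgext E.
Proof.
pose s := undup (dom D ++ dom E ++ dom (D - E)).
have us : uniq s by exact: undup_uniq.
have sub F : {subset dom F <= dom D ++ dom E ++ dom (D - E)} ->
    fgext F = \sum_(x <- s) f x *~ coeff x F.
  by move=> h; apply: fgext_sub => // x /h; rewrite mem_undup.
rewrite !sub.
all: try by move=> x xD; rewrite !mem_cat xD ?orbT.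
by rewrite -sumrB; apply: eq_bigr => x _; rewrite coeffB mulrzBr.
Qed.

HB.instance Definition _ := GRing.isZmodMorphism.Build _ _ fgext fgextB.

Lemma fgextU (x : K) : fgext << x >> = f x.
Proof. by rewrite /fgext domU1 big_seq1 coeffU eqxx mulr1. Qed.

End FreeAbelian.

Lemma eq_fgext (K : choiceType) (V : zmodType) (f g : K -> V) :
  f =1 g -> fgext f =1 fgext g.
Proof. by move=> fg D; apply: eq_bigr => x _; rewrite fg. Qed.

Lemma raddf_fgext (K : choiceType) (V W : zmodType) (h : {additive V -> W})
    (f : K -> V) (D : {freeg K / int}) : h (fgext f D) = fgext (h \o f) D.
Proof. by rewrite raddf_sum; apply: eq_bigr => x _; rewrite raddfMz. Qed.

(* [A] with a right action [ra] of [G] and [C] with a left action [la] of [G]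
   (both by additive maps) are a right, resp. left, ZG-module. As ZG is
   generated by [G] as a ring, A (x)_{ZG} C is the free abelian group on A * C
   modulo biadditivity and (a . g) (x) c = a (x) (g . c). *)
Section Tensor.
Context (G : Type) (A C : zmodType) (ra : A -> G -> A) (la : G -> C -> C).

Local Notation F := {freeg (A * C)%type / int}.

Definition tensor_gen : set F := fun x =>
  [\/ exists a a' c, x = << (a + a', c) >> - << (a, c) >> - << (a', c) >>,
      exists a c c', x = << (a, c + c') >> - << (a, c) >> - << (a, c') >> |
      exists a g c, x = << (ra a g, c) >> - << (a, la g c) >>].

Definition tensor_rel : {pred F} := fun x =>
  `[< forall S : {pred F}, zmod_closed S ->
        (forall y, tensor_gen y -> y \in S) -> x \in S >].

Lemma tensor_rel_closed : zmod_closed tensor_rel.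
Proof.
split; first by apply/asboolP => S [].
move=> x y /asboolP xS /asboolP yS; apply/asboolP => S cS gS.
by apply: cS.2; [exact: xS | exact: yS].
Qed.

HB.instance Definition _ := GRing.isZmodClosed.Build _ tensor_rel
  tensor_rel_closed.

Definition tensor : Type := Quotient.quot tensor_rel.
HB.instance Definition _ := GRing.Zmodule.on tensor.

Definition tens (a : A) (c : C) : tensor :=
  (\pi_(Quotient.quot tensor_rel) << (a, c) >>).

Lemma tensor_gen_rel (x : F) : tensor_gen x -> x \in tensor_rel.
Proof. by move=> gx; apply/asboolP => S _; exact. Qed.

Lemma tensDl a a' c : tens (a + a') c = tens a c + tens a' c.
Proof.
rewrite /tens -[RHS]raddfD; apply/eqP.
rewrite -Quotient.idealrBE opprD addrA.
by apply: tensor_gen_rel; apply: Or31; exists a, a', c.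
Qed.

Lemma tensDr a c c' : tens a (c + c') = tens a c + tens a c'.
Proof.
rewrite /tens -[RHS]raddfD; apply/eqP.
rewrite -Quotient.idealrBE opprD addrA.
by apply: tensor_gen_rel; apply: Or32; exists a, c, c'.
Qed.

Lemma tens_bal a g c : tens (ra a g) c = tens a (la g c).
Proof.
apply/eqP; rewrite -Quotient.idealrBE.
by apply: tensor_gen_rel; apply: Or33; exists a, g, c.
Qed.

(* the additive map sending [tens a c] to [b a c]; it is meaningful when [b] is
   biadditive and balanced, see [textE] *)
Definition text (V : zmodType) (b : A -> C -> V) (x : tensor) : V :=
  fgext (fun ac => b ac.1 ac.2) (repr (x : Quotient.quot tensor_rel)).

Section Text.
Context (V : zmodType) (b : A -> C -> V).
Hypothesis b_addl : forall a a' c, b (a + a') c = b a c + b a' c.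
Hypothesis b_addr : forall a c c', b a (c + c') = b a c + b a c'.
Hypothesis b_bal : forall a g c, b (ra a g) c = b a (la g c).

Lemma text_pi (x : F) :
  text b (\pi_(Quotient.quot tensor_rel) x) = fgext (fun ac => b ac.1 ac.2) x.
Proof.
rewrite /text; set y := repr _; set h := fgext _.
have : y - x \in tensor_rel.
  rewrite Quotient.idealrBE; apply/eqP; exact: reprK.
move=> /asboolP /(_ [pred z | h z == 0]) H.
suff : y - x \in [pred z | h z == 0].
  by rewrite inE /h fgextB subr_eq0 => /eqP.
apply: H.
- split; first by rewrite inE /h raddf0.
  by move=> u v; rewrite !inE /h fgextB => /eqP -> /eqP ->; rewrite subrr.
- move=> z [[a [a' [c ->]]]|[a [c [c' ->]]]|[a [g [c ->]]]];
    rewrite inE /h !fgextB !fgextU /=.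
  + by rewrite b_addl addrAC addrK subrr.
  + by rewrite b_addr addrAC addrK subrr.
  + by rewrite b_bal subrr.
Qed.

Lemma textE a c : text b (tens a c) = b a c.
Proof. by rewrite text_pi fgextU. Qed.

Lemma textB : {morph text b : x y / x - y}.
Proof.
by move=> x y; rewrite -[x]reprK -[y]reprK -[_ - _]raddfB !text_pi raddfB.
Qed.

End Text.
End Tensor.

Section Simplices.
Context (R : realType).

Definition stdsimplex (n : nat) : set 'rV[R]_n.+1 :=
  [set x | (forall i, 0 <= x ord0 i) /\ \sum_i x ord0 i = 1].
Arguments stdsimplex : clear implicits.

Definition face_row n (i : 'I_n.+2) (x : 'rV[R]_n.+1) : 'rV[R]_n.+2 :=
  \row_j (if unlift i j is Some k then x ord0 k else 0).

Lemma face_row_stdsimplex n (i : 'I_n.+2) (x : 'rV[R]_n.+1) :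
  stdsimplex n x -> stdsimplex n.+1 (face_row i x).
Proof.
case=> x0 x1; split=> [j|]; first by rewrite mxE; case: unlift.
rewrite (bigD1_ord i) //= mxE unlift_none add0r -x1.
by apply: eq_bigr => j _; rewrite mxE liftK.
Qed.

Lemma face_row_continuous n (i : 'I_n.+2) : continuous (face_row i).
Proof.
move=> x A [P Px PA].
exists (fun (a : 'I_1) (b : 'I_n.+1) => P ord0 (lift i b)).
  move=> a b; have := Px ord0 (lift i b).
  by rewrite mxE liftK (ord1 a).
move=> y Py; apply: PA => a b; rewrite mxE (ord1 a).
case: unliftP => [k ->|->]; first exact: Py.
by have := Px ord0 i; rewrite mxE unlift_none => /nbhs_singleton.
Qed.

Definition face n (i : 'I_n.+2) (x : stdsimplex n) : stdsimplex n.+1 :=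
  exist _ (face_row i (set_val x))
    (mem_set (face_row_stdsimplex i (set_mem (valP x)))).

Lemma face_continuous n (i : 'I_n.+2) : continuous (@face n i).
Proof.
apply: continuous_comp_initial.
move=> x.
apply: (@continuous_comp _ _ _ (@set_val _ (stdsimplex n)) (face_row i)).
  exact: (@initial_continuous _ _ (@set_val _ (stdsimplex n))).
exact: face_row_continuous.
Qed.

HB.instance Definition _ n (i : 'I_n.+2) :=
  isContinuous.Build _ _ (@face n i) (@face_continuous n i).

End Simplices.
Arguments stdsimplex : clear implicits.
Arguments face {R n}.

Section SingularChains.
Context (R : realType).
Implicit Types T U W : topologicalType.

Local Notation singular n T := (continuousType (stdsimplex R n) T).

Definition chain n T : zmodType := {freeg (singular n T) / int}.

Definition push n T U (f : continuousType T U) : chain n T -> chain n U :=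
  fgext (fun s : singular n T => << (f \o s : singular n U) >>).
HB.instance Definition _ n T U (f : continuousType T U) :=
  GRing.isZmodMorphism.Build _ _ (@push n T U f) (fgextB _).

Lemma pushU n T U (f : continuousType T U) (s : singular n T) :
  push f << s >> = << (f \o s : singular n U) >>.
Proof. exact: fgextU. Qed.

Definition boundary n T : chain n.+1 T -> chain n T :=
  fgext (fun s : singular n.+1 T =>
    \sum_(i < n.+2) << (s \o face i : singular n T) >> *~ (-1) ^+ i).
HB.instance Definition _ n T :=
  GRing.isZmodMorphism.Build _ _ (@boundary n T) (fgextB _).

Lemma boundaryU n T (s : singular n.+1 T) :
  boundary << s >> =
  \sum_(i < n.+2) << (s \o face i : singular n T) >> *~ (-1) ^+ i.
Proof. exact: fgextU. Qed.

Lemma boundary_push n T U (f : continuousType T U) (c : chain n.+1 T) :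
  boundary (push f c) = push f (boundary c).
Proof.
rewrite [LHS]raddf_fgext [RHS]raddf_fgext; apply: eq_fgext => s /=.
rewrite boundaryU raddf_sum; apply: eq_bigr => i _.
rewrite raddfMz /= !pushU; congr (<< _ >> *~ _).
exact/continuousEP.
Qed.

Lemma push_comp n T U W (f : continuousType T U) (h : continuousType U W)
    (k : continuousType T W) (c : chain n T) :
  h \o f =1 k -> push h (push f c) = push k c.
Proof.
move=> hf; rewrite [LHS]raddf_fgext; apply: eq_fgext => s /=.
rewrite !pushU; congr << _ >>; apply/continuousEP => x /=.
exact: hf.
Qed.

(* the boundary, also defined (as 0) in degree 0 *)
Definition boundary0 n T : chain n T -> chain n.-1 T :=
  match n with 0 => fun=> 0 | m.+1 => @boundary m T end.

Definition chain_in n T (A : set T) : set (chain n T) :=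
  [set c | forall s : singular n T, s \in dom c -> range s `<=` A].

End SingularChains.
Notation singular R n T := (continuousType (stdsimplex R n) T).

(* isomorphic, as a measurable space, to a Polish space with its Borel sets *)
Definition standard_borel (R : realType) d (X : measurableType d) : Prop :=
  exists (P : completePseudoMetricType R) (f : X -> P) (h : P -> X),
    [/\ hausdorff_space P,
        (exists2 D : set P, countable D & dense D),
        cancel f h /\ cancel h f,
        (forall B, <<s @open P >> B -> measurable (f @^-1` B)) &
        (forall A, measurable A -> <<s @open P >> (h @^-1` A))].

Record std_space (R : realType) (G : groupType) := StdSpace {
  sp_display : measure_display;
  sp_carrier :> measurableType sp_display;
  sp_measure : probability sp_carrier R;
  sp_act : G -> sp_carrier -> sp_carrier;
  sp_standard : standard_borel R sp_carrier;
  sp_act1 : forall x, sp_act 1%g x = x;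
  sp_actM : forall g h x, sp_act (g * h)%g x = sp_act g (sp_act h x);
  sp_act_measurable : forall g, measurable_fun setT (sp_act g);
  sp_act_preserving : forall g A, measurable A ->
    sp_measure (sp_act g @^-1` A) = sp_measure A }.

Section StdSpaceProperties.
Context (R : realType) (G : groupType).
Implicit Types alpha beta : std_space R G.

Definition essentially_free alpha : Prop :=
  {ae sp_measure alpha, forall x, forall g, sp_act g x = x -> g = 1%g}.

Definition non_atomic alpha : Prop :=
  forall A : set alpha, measurable A -> (0 < sp_measure alpha A)%E ->
  exists B, [/\ measurable B, B `<=` A, (0 < sp_measure alpha B)%E &
                (sp_measure alpha B < sp_measure alpha A)%E].

Definition weakly_contained alpha beta : Prop :=
  forall (eps : R) (F : seq G) (m : nat) (A : 'I_m -> set alpha),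
  0 < eps -> (forall j, measurable (A j)) ->
  exists B : 'I_m -> set beta,
    (forall j, measurable (B j)) /\
    forall g j k, g \in F ->
      (`| sp_measure alpha (sp_act g @` A j `&` A k)
          - sp_measure beta (sp_act g @` B j `&` B k) | < eps%:E)%E.

End StdSpaceProperties.

Section Linfty.
Context d (X : measurableType d) (R : realType) (mu : probability X R).

(* measurability is with respect to the discrete sigma-algebra on Z *)
Definition Zbounded : {pred X -> int} := fun f =>
  `[< (forall A : set int, measurable (f @^-1` A)) /\
      exists k : int, {ae mu, forall x, `|f x| <= k} >].

Lemma Zbounded_cst (k : int) : cst k \in Zbounded.
Proof.
apply/asboolP; split=> [A|]; last by exists `|k|; apply/nearW.
by rewrite preimage_cst; case: ifP.
Qed.

Lemma Zbounded_closed : zmod_closed Zbounded.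
Proof.
split; first exact: Zbounded_cst.
move=> f h /asboolP[mf [k fk]] /asboolP[mh [l hl]]; apply/asboolP; split.
  move=> A.
  rewrite (_ : _ @^-1` _ = \bigcup_(z : int * int)
     (if (z.1 - z.2) \in A then f @^-1` [set z.1] `&` h @^-1` [set z.2]
      else set0)).
    apply: countable_bigcupT_measurable => // z; case: ifP => // _.
    exact: measurableI.
  apply/seteqP; split=> [x /= Ax|x [z _]].
    by exists (f x, h x) => //=; rewrite mem_set.
  case: ifP => // /set_mem Az [/= fz hz].
  by change (A (f x - h x)); rewrite fz hz.
exists (k + l); apply: filterS2 fk hl => x fx hx.
by rewrite (le_trans (ler_normB _ _))// lerD.
Qed.

HB.instance Definition _ := GRing.isZmodClosed.Build _ Zbounded Zbounded_closed.

Definition Zfun : Type := {f : X -> int | f \in Zbounded}.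
HB.instance Definition _ := SubChoice.on Zfun.
HB.instance Definition _ := [SubChoice_isSubZmodule of Zfun by <:].

Definition Znull : {pred Zfun} := fun f =>
  `[< {ae mu, forall x, (val f : X -> int) x = 0} >].

Lemma Znull_closed : zmod_closed Znull.
Proof.
split; first by apply/asboolP; apply/nearW.
move=> f h /asboolP f0 /asboolP h0; apply/asboolP.
apply: filterS2 f0 h0 => x fx hx.
by change (val f x - val h x = 0); rewrite fx hx subrr.
Qed.

HB.instance Definition _ := GRing.isZmodClosed.Build _ Znull Znull_closed.

Definition Linfty : Type := Quotient.quot Znull.
HB.instance Definition _ := GRing.Zmodule.on Linfty.

Definition Linfty_cst (k : int) : Linfty :=
  \pi_(Quotient.quot Znull) (exist _ (cst k) (Zbounded_cst k)).

Lemma Linfty_cstD : {morph Linfty_cst : k l / k + l}.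
Proof.
move=> k l; rewrite /Linfty_cst -[RHS]raddfD.
by apply/(congr1 (\pi_(Quotient.quot Znull)))/val_inj/funext.
Qed.

Definition Linfty_norm (f : Linfty) : \bar R :=
  let f0 : X -> int := val (repr (f : Quotient.quot Znull)) in
  (\int[mu]_x (`|f0 x|%:~R)%:E)%E.

End Linfty.
Arguments Znull {d X R} mu.
Arguments Linfty_cst {d X R} mu k.

Section LinftyAction.
Context (R : realType) (G : groupType) (alpha : std_space R G).
Local Notation mu := (sp_measure alpha).

Lemma Zbounded_act (f : Zfun mu) (g : G) :
  (val f : alpha -> int) \o sp_act g \in Zbounded mu.
Proof.
have /asboolP[mf [k [N [mN N0 fN]]]] := valP f.
apply/asboolP; split=> [A|].
  rewrite comp_preimage -[X in measurable X]setTI.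
  exact: sp_act_measurable.
exists k, (sp_act g @^-1` N); split.
- by rewrite -[X in measurable X]setTI; exact: sp_act_measurable.
- by rewrite sp_act_preserving.
- by move=> x /= fx; exact: fN.
Qed.

Definition Zfun_act (f : Zfun mu) (g : G) : Zfun mu :=
  exist _ (_ \o _) (Zbounded_act f g).

Definition Linfty_act (f : Linfty mu) (g : G) : Linfty mu :=
  \pi_(Quotient.quot (Znull mu))
    (Zfun_act (repr (f : Quotient.quot (Znull mu))) g).

Lemma Linfty_actE (f : Zfun mu) (g : G) :
  Linfty_act (\pi_(Quotient.quot (Znull mu)) f) g =
  \pi_(Quotient.quot (Znull mu)) (Zfun_act f g).
Proof.
apply/eqP; rewrite -Quotient.idealrBE; set h := repr _.
have : h - f \in Znull mu by rewrite Quotient.idealrBE reprK.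
move=> /asboolP[N [mN N0 hN]]; apply/asboolP; exists (sp_act g @^-1` N); split.
- by rewrite -[X in measurable X]setTI; exact: sp_act_measurable.
- by rewrite sp_act_preserving.
- by move=> x /= fx; exact: hN.
Qed.

Lemma Linfty_act_cst (k : int) (g : G) :
  Linfty_act (Linfty_cst mu k) g = Linfty_cst mu k.
Proof.
rewrite /Linfty_cst Linfty_actE.
by apply/(congr1 (\pi_(Quotient.quot (Znull mu))))/val_inj/funext.
Qed.

End LinftyAction.

Section Topology.
Context (R : realType).
Implicit Types T U : topologicalType.

Definition homeo_on T U (A : set T) (B : set U) (f : T -> U)
    (h : U -> T) : Prop :=
  [/\ {within A, continuous f}, {within B, continuous h},
      f @` A `<=` B, h @` B `<=` A &
      {in A, cancel f h} /\ {in B, cancel h f}].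

Definition topological_manifold (n : nat) T : Prop :=
  [/\ hausdorff_space T, @second_countable T &
      forall x : T, exists (A : set T) (B : set 'rV[R]_n) f h,
        [/\ open A, A x, open B & homeo_on A B f h]].

(* paths are functions on R of which only the restriction to [0, 1] matters *)
Definition is_path T (x y : T) (c : R -> T) : Prop :=
  [/\ {within `[0, 1], continuous c}, c 0 = x & c 1 = y].

Definition path_cat T (c c' : R -> T) : R -> T :=
  fun t => if t <= 2^-1 then c (2 * t) else c' (2 * t - 1).

Definition path_homotopic T (c c' : R -> T) : Prop :=
  exists H : R * R -> T,
    [/\ {within `[0, 1]%classic `*` `[0, 1]%classic, continuous H},
        (forall t, t \in `[0, 1] -> H (0, t) = c t /\ H (1, t) = c' t) &
        (forall s, s \in `[0, 1] -> H (s, 0) = c 0 /\ H (s, 1) = c 1)].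

Definition simply_connected T : Prop :=
  (forall x y : T, exists c, is_path x y c) /\
  (forall (x : T) c, is_path x x c -> path_homotopic c (cst x)).

Definition covering_map T U (p : continuousType T U) : Prop :=
  forall x : U, exists (A : set U) (I : Type) (V : I -> set T),
    [/\ open A /\ A x, (forall i, open (V i)), trivIset setT V,
        p @^-1` A = \bigcup_i V i &
        forall i, exists h : U -> T, homeo_on (V i) A p h].

(* [phi] induces an isomorphism from pi_1(T, x) onto [G]; its values on
   functions that are not loops at [x] are irrelevant *)
Definition fundamental_group (G : groupType) T (x : T)
    (phi : (R -> T) -> G) : Prop :=
  [/\ (forall c c', is_path x x c -> is_path x x c' ->
         (phi c = phi c' <-> path_homotopic c c')),
      (forall c c', is_path x x c -> is_path x x c' ->
         phi (path_cat c c') = (phi c * phi c')%g) &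
      (forall g, exists c, is_path x x c /\ phi c = g)].

(* [p] is a universal covering of a space with fundamental group [G], on which
   [G] acts by deck transformations: the action of the class of a loop sends
   the base point to the end point of the lift of the loop. *)
Definition universal_covering (G : groupType) T U (p : continuousType T U)
    (deck : G -> continuousType T T) : Prop :=
  [/\ covering_map p, simply_connected T,
      (forall y, deck 1%g y = y) /\
      (forall g h y, deck (g * h)%g y = deck g (deck h y)),
      (forall g y, p (deck g y) = p y) &
      exists (y0 : T) (phi : (R -> U) -> G),
        fundamental_group (p y0) phi /\
        forall c y1, is_path y0 y1 c -> p y1 = p y0 ->
          deck (phi (p \o c)) y0 = y1].

End Topology.

Section Orientation.
Context (R : realType) (n : nat) (M : topologicalType).

(* relative cycles and homology modulo the chains lying in [A], that is, the
   elements of H_n(M, A) and their equality *)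
Definition rel_cycle (A : set M) (c : chain R n M) : Prop :=
  chain_in A (boundary0 c).

Definition rel_homologous (A : set M) (c c' : chain R n M) : Prop :=
  exists e : chain R n.+1 M, chain_in A (c - c' - boundary e).

(* the class of [c] generates the infinite cyclic group H_n(M, M \ {x}) *)
Definition local_generator (x : M) (c : chain R n M) : Prop :=
  rel_cycle (~` [set x]) c /\
  forall c', rel_cycle (~` [set x]) c' ->
    exists k : int, rel_homologous (~` [set x]) c' (c *~ k).

(* [o x] is a relative cycle representing the local orientation at [x] *)
Definition orientation (o : M -> chain R n M) : Prop :=
  (forall x, local_generator x (o x)) /\
  (forall x, exists (A : set M) (u : chain R n M),
     [/\ open A, A x, rel_cycle (~` A) u &
         forall y, A y -> rel_homologous (~` [set y]) u (o y)]).

(* the cycles representing the integral fundamental class [M]_Z *)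
Definition fundamental_cycle (o : M -> chain R n M) (z : chain R n M) : Prop :=
  boundary0 z = 0 /\ forall x, rel_homologous (~` [set x]) z (o x).

End Orientation.

Section ParametrizedSimplicialVolume.
Context (R : realType) (M Mt : topologicalType) (G : groupType).
Variables (p : continuousType Mt M) (deck : G -> continuousType Mt Mt).
Variable alpha : std_space R G.
Local Notation mu := (sp_measure alpha).

Definition deck_chain n (g : G) : chain R n Mt -> chain R n Mt := push (deck g).

Local Notation "f ⊗ c" := (tens (@Linfty_act R G alpha) (@deck_chain _) f c)
  (at level 40).
Local Notation "k ⊗Z c" :=
  (tens (fun (k : int) (_ : G) => k) (@deck_chain _) k c) (at level 40).

(* Z (x)_{ZG} C_n(Mt; Z) *)
Definition coinv_chain n : zmodType :=
  tensor (fun (k : int) (_ : G) => k) (@deck_chain n).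

(* C_n(M; alpha) *)
Definition param_chain n : zmodType :=
  tensor (@Linfty_act R G alpha) (@deck_chain n).

Definition param_boundary n : param_chain n.+1 -> param_chain n :=
  text (fun f c => f ⊗ boundary c).

(* the isomorphism onto C_n(M; Z) *)
Definition coinv_proj n : coinv_chain n -> chain R n M :=
  text (fun k c => push p c *~ k).

Definition coinv_incl n : coinv_chain n -> param_chain n :=
  text (fun k c => Linfty_cst mu k ⊗ c).

Lemma param_boundaryE n f (c : chain R n.+1 Mt) :
  param_boundary (f ⊗ c) = f ⊗ boundary c.
Proof.
apply: textE => [a a' c'|a c' c''|a g c']; first exact: tensDl.
- by rewrite raddfD tensDr.
- by rewrite tens_bal /deck_chain boundary_push.
Qed.

Lemma coinv_projE n k (c : chain R n Mt) :
  (forall g y, p (deck g y) = p y) ->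
  coinv_proj (k ⊗Z c) = push p c *~ k.
Proof.
move=> pdeck; apply: textE => [a a' c'|a c' c''|a g c'].
- exact: mulrzDr.
- by rewrite raddfD mulrzDl.
- by congr (_ *~ _); rewrite (push_comp (k := p)) // => y; exact: pdeck.
Qed.

Lemma coinv_inclE n k (c : chain R n Mt) :
  coinv_incl (k ⊗Z c) = Linfty_cst mu k ⊗ c.
Proof.
apply: textE => [a a' c'|a c' c''|a g c']; first by rewrite Linfty_cstD tensDl.
- exact: tensDr.
- by rewrite -tens_bal Linfty_act_cst.
Qed.

(* [c] is homologous to the image of a cycle representing [M]_Z; it is thus
   a cycle *)
Definition param_fundamental_cycle n (o : M -> chain R n M)
    (c : param_chain n) : Prop :=
  exists (t : coinv_chain n) (e : param_chain n.+1),
    fundamental_cycle o (coinv_proj t) /\ c = coinv_incl t + param_boundary e.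

(* [r] is the norm of [c]: [s] and [f] form a reduced form of [c]; zero
   coefficients [f j] are allowed and do not contribute *)
Definition param_norm n (c : param_chain n) (r : \bar R) : Prop :=
  exists (k : nat) (f : 'I_k -> Linfty mu) (s : 'I_k -> singular R n Mt),
    [/\ injective (fun j => p \o s j : singular R n M),
        c = \sum_(j < k) f j ⊗ << s j >> &
        r = (\sum_(j < k) Linfty_norm (f j))%E].

Definition param_simplicial_volume n (o : M -> chain R n M) : \bar R :=
  ereal_inf [set r | exists c, param_fundamental_cycle o c /\ param_norm c r].

End ParametrizedSimplicialVolume.

(* Main.v *)
Require Import Defs.
From mathcomp Require Import freeg.
From mathcomp Require Import all_boot all_order all_algebra.
From mathcomp Require Import all_classical all_reals all_analysis.
From mathcomp Require Import measurable_realfun ring_quotient generic_quotient.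
From mathcomp Require Import zify ring lra.
Set Implicit Arguments.
Unset Strict Implicit.
Unset Printing Implicit Defensive.
Import Order.TTheory GRing.Theory Num.Theory numFieldNormedType.Exports.
Local Open Scope classical_set_scope.
Local Open Scope ring_scope.


(** Only upper bounds on measures need to be transferred. The finitely many
    functions on X that witness c = z + d e in C_*(M; alpha) factor through a
    measurable map q from X to a finite set V. Weak containment, applied to the
    fibres of q, yields a measurable psi : Y -> V such that
      nu (psi = v, psi o g = w) <= mu (q = v, q o g = w) + eps
    for the finitely many g involved. Composition with psi in place of q turns
    every function v o q into v o psi; since an identity between functions on X
    says that certain of the sets on the right are null, this map
    L^oo(X, Z) -> L^oo(Y, Z) is additive, equivariant and norm-decreasing up to
    a small L^1-error on the functions involved. It therefore sends the finitely
    many tensor relations used in c = z + d e to chains of small norm, and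
    z + d e' is a beta-parametrized fundamental cycle of norm at most that of c
    plus a small error. *)

(** * Lifts of simplices to the universal covering *)

(** The hypothesis makes both [E] and its complement relatively open in [A], so the trace of [E] on
    the connected set [A] is empty or all of [A]. *)
Lemma connected_locally_constant (T : topologicalType) (A E : set T) :
  connected A ->
  (forall x, A x -> \forall y \near x, A y -> (E x <-> E y)) ->
  forall x y, A x -> A y -> E x -> E y.
Proof.
move=> cA loc x y Ax Ay Ex.
(* Relative openness is witnessed by an open set of the whole space: the interior of the points that
   satisfy [P] or lie outside [A]. *)
have opn (P : T -> Prop) :
    (forall z, A z -> \forall w \near z, A w -> (P z <-> P w)) ->
    A `&` P = A `&` (A `&` P `|` ~` A)°.
  move=> lP; apply/seteqP; split=> z [Az]; last first.
    by move=> /nbhs_singleton [[] //|/(_ Az)].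
  move=> Pz; split=> //; apply: filterS (lP z Az) => w zw.
  by have [Aw|nAw] := pselect (A w); [left; split=> //; apply/zw|right].
have : A `&` E = A.
  apply: cA; first by exists x.
    by exists (A `&` E `|` ~` A)°; [exact: open_interior|exact: opn].
  exists (~` (A `&` ~` E `|` ~` A)°); first exact/open_closedC/open_interior.
  have -> : A `&` E = A `\` (A `&` ~` E).
    by apply/seteqP; split=> z [Az Ez]; split=> //; [case|apply: contrapT => nE; exact: Ez].
  rewrite [in LHS]opn; last first.
    by move=> z /loc; apply: filterS => w zw /zw; rewrite -iff_not2.
  apply/seteqP; split=> z [Az nz]; split=> //.
    by move=> zi; apply: nz.
  by case=> _ zi; apply: nz.
by move=> AE; have : (A `&` E) y by [rewrite AE]; case.
Qed.

Section Covering.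
Variables (R : realType) (T U : topologicalType) (p : continuousType T U).
Hypothesis covp : covering_map p.

(** The locus where [f] and [g] agree is locally constant: near a point each map stays in one sheet,
    and as [p] is injective on sheets, the maps agree exactly when the two sheets coincide. *)
Lemma lift_unique (C : topologicalType) (A : set C) (f g : C -> T) (a : C) :
  connected A -> {within A, continuous f} -> {within A, continuous g} ->
  (forall x, A x -> p (f x) = p (g x)) -> A a -> f a = g a ->
  forall x, A x -> f x = g x.
Proof.
move=> cA /subspace_continuousP cf /subspace_continuousP cg pfg Aa fga x Ax.
apply: (connected_locally_constant (E := fun x => f x = g x) cA) Aa Ax fga.
move=> {a}y Ay.
have [B [I [V [[oB By] oV tV pV hV]]]] := covp (p (f y)).
have [i _ Vi] : (\bigcup_i V i) (f y) by rewrite -pV.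
have [j _ Vj] : (\bigcup_i V i) (g y) by rewrite -pV /preimage /= -pfg.
have nf : \forall z \near y, A z -> V i (f z).
  by apply: (cf y Ay); exact: open_nbhs_nbhs.
have ng : \forall z \near y, A z -> V j (g z).
  by apply: (cg y Ay); exact: open_nbhs_nbhs.
apply: filterS2 nf ng => z fz gz Az.
have sheet w : A w -> V i (f w) -> V j (g w) -> f w = g w <-> i = j.
  move=> Aw fw gw; split=> [fgw|ij].
    by apply: (tV i j) => //; exists (f w); split=> //; rewrite fgw.
  have [h [_ _ _ _ [ph _]]] := hV i.
  by rewrite -(ph (f w)) ?inE// pfg// ph// inE ij.
apply: iff_trans (sheet y Ay Vi Vj) (iff_sym _).
by apply: sheet => //; [exact: fz|exact: gz].
Qed.

End Covering.

Section Clamp.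
Variable R : realType.

(** The retraction of the line onto the unit interval. Precomposing with it makes a path continuous
    on all of [R], so that no subspace topology is needed on the domain. *)
Definition clamp (t : R) : R := Num.max 0 (Num.min 1 t).

Lemma clamp_bounds t : 0 <= clamp t <= 1.
Proof. by rewrite /clamp le_max lexx /= ge_max ler01 ge_min lexx. Qed.

Lemma clamp_id t : 0 <= t <= 1 -> clamp t = t.
Proof. by move=> /andP[t0 t1]; rewrite /clamp min_r// max_r. Qed.

Lemma clamp_continuous : continuous clamp.
Proof.
move=> t; apply: (@continuous_max R R (cst 0) (cst 1 \min id)).
  by apply: cst_continuous.
have c1 : {for t, continuous (cst 1 : R -> R^o)} by exact: cst_continuous.
exact: (continuous_min c1 (@cvg_id _ _)).
Qed.

Lemma path_clamp_continuous (T : topologicalType) (c : R -> T) :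
  {within `[0, 1], continuous c} -> continuous (c \o clamp).
Proof.
move=> /subspace_continuousP cc t.
have := cc (clamp t); rewrite /= in_itv /= clamp_bounds => /(_ isT) ct.
move=> N /ct cN; have cl := @clamp_continuous t _ cN.
suff : nbhs t [set s | N (c (clamp s))] by [].
near=> s; apply: (near (cl : \forall s \near t, _) s) => //=.
by rewrite /= in_itv /= clamp_bounds.
Unshelve. all: by end_near.
Qed.

End Clamp.

Section DeckTransformations.
Variables (R : realType) (G : groupType) (T U : topologicalType).
Variables (p : continuousType T U) (deck : G -> continuousType T T).
Hypothesis univ : universal_covering R p deck.

Let covp : covering_map p. Proof. by case: univ. Qed.

(** Transitivity on the fibre of the base point is given by [phi]. It spreads to every other fibre
    along a path, because transitivity on the fibre over [p (d t)] is locally constant in [t]. *)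
Lemma deck_fiber (y z : T) : p y = p z -> exists g, deck g y = z.
Proof.
have [_ [pathT _] [deck1 deckM] pdeck [y0 [phi [_ phiE]]]] := univ.
pose trans u := forall y z, p y = u -> p z = u -> exists g, deck g y = z.
suff : trans (p y) by move=> tr pyz; exact: tr.
have [c [cc c0 c1]] := pathT y0 y.
have cR := path_clamp_continuous cc.
set d := c \o @clamp R in cR.
have d0 : d 0 = y0 by rewrite /d /= clamp_id// lexx ler01.
have d1 : d 1 = y by rewrite /d /= clamp_id// lexx ler01.
rewrite -d1.
have pd : continuous (p \o d).
  by move=> x; apply: continuous_comp; [exact: cR|exact: cts_fun].
have cT : connected [set: R] by apply/connected_intervalP.
apply: (connected_locally_constant (E := fun t => trans (p (d t))) cT _ (x := 0)) => //.
  move=> t _; have [B [I [V [[oB By] oV tV pV hV]]]] := covp (p (d t)).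
  have [e /= e0 eB] : exists2 e : R, 0 < e & ball t e `<=` [set s | B (p (d s))].
    apply/nbhs_ballP.
    by apply: (pd t); exact: open_nbhs_nbhs.
  have cball : connected (ball t e).
    by apply/connected_intervalP; rewrite ball_itv; exact: interval_is_interval.
  apply/nbhs_ballP; exists e => //= s ts _.
  have tt : ball t e t by exact: ballxx.
  suff sub a b : ball t e a -> ball t e b -> trans (p (d a)) -> trans (p (d b)).
    by split; exact: sub.
  move=> ta tb tr w w' pw pw'.
  (* Over the ball, [p \o d] stays in the evenly covered set [B], so following a sheet lifts it
     through any prescribed point over [d b]. *)
  have lft u : p u = p (d b) -> exists l : R -> T,
      [/\ {within ball t e, continuous l}, l b = u &
           forall x, ball t e x -> p (l x) = p (d x)].
    move=> pu; have [i _ Vi] : (\bigcup_i V i) u.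
      by rewrite -pV /preimage /= pu; exact: eB.
    have [h [_ /subspace_continuousP ch _ hB [ph hp]]] := hV i.
    exists (h \o p \o d); split.
    - apply/subspace_continuousP => x tx.
      have := ch (p (d x)) (eB _ tx).
      move=> hx N /hx /(pd x) H.
      suff : \forall r \near x, ball t e r -> N (h (p (d r))) by [].
      near=> r => tr'; apply: (near (H : \forall s \near x, _) r) => //=.
      exact: eB.
    - by rewrite /= -pu ph// inE.
    - by move=> x tx; rewrite /= hp// inE; exact: eB.
  have [l [cl lb pl]] := lft w pw; have [l' [cl' lb' pl']] := lft w' pw'.
  (* A deck transformation that matches the two lifts at [a] matches them at [b], by uniqueness of
     lifts. *)
  have [g ga] := tr (l a) (l' a) (pl a ta) (pl' a ta).
  exists g; rewrite -lb -lb'.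
  apply: (lift_unique covp cball (f := deck g \o l) _ cl' _ ta) => //.
    by move=> x; apply: (@continuous_comp (subspace (ball t e)) T T l (deck g));
      [exact: cl|exact: cts_fun].
  by move=> x tx; rewrite /= pdeck pl// pl'.
rewrite d0 => w w' pw pw'.
have fib v : p v = p y0 -> exists g, deck g y0 = v.
  by move=> pv; have [e pe] := pathT y0 v; exists (phi (p \o e)); exact: phiE.
have [g gw] := fib w pw; have [h hw] := fib w' pw'.
exists (h * g^-1)%g.
by rewrite deckM -gw -(deckM g^-1%g) mulVg deck1.
Unshelve. all: by end_near.
Qed.

(** A deck transformation is chosen to match the simplices at one vertex. Uniqueness of lifts along
    the straight segment from that vertex to [x] then forces agreement at every [x]. *)
Lemma deck_simplex n (s s' : singular R n T) :
  p \o s =1 p \o s' -> exists g, deck g \o s =1 s'.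
Proof.
move=> pss.
pose e0 : 'rV[R]_n.+1 := \row_j (j == ord0)%:R.
have e0s : stdsimplex R n e0.
  split=> [i|]; first by rewrite mxE ler0n.
  rewrite (bigD1 ord0) //= mxE eqxx big1 ?addr0// => i /negPf i0.
  by rewrite mxE i0.
pose seg (x : stdsimplex R n) (t : R) : 'rV[R]_n.+1 :=
  (1 - clamp t) *: e0 + clamp t *: set_val x.
have segs x t : seg x t \in stdsimplex R n.
  have /andP[t0 t1] := clamp_bounds t.
  have [x0 x1] := set_mem (valP x).
  apply/mem_set; split=> [i|].
    by rewrite !mxE addr_ge0// mulr_ge0// ?subr_ge0// ler0n.
  under eq_bigr do rewrite !mxE.
  rewrite big_split /= -!mulr_sumr x1 mulr1.
  have [_] := e0s; under eq_bigr do rewrite mxE.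
  by move=> ->; rewrite mulr1 subrK.
pose sg x t : stdsimplex R n := exist _ (seg x t) (segs x t).
have csg x : continuous (sg x).
  apply: continuous_comp_initial => t.
  rewrite (_ : _ \o _ = seg x)//.
  apply: cvgD; apply: cvgZ; try exact: cvg_cst; last exact: clamp_continuous.
  by apply: cvgB; [exact: cvg_cst|exact: clamp_continuous].
pose x0 : stdsimplex R n := exist _ e0 (mem_set e0s).
have [g gx] := deck_fiber (pss x0).
have [_ _ _ pdeck _] := univ.
have sg0 x : sg x 0 = x0.
  by apply: val_inj; rewrite /= /seg clamp_id ?lexx ?ler01// subr0 scale1r scale0r addr0.
have sg1 x : sg x 1 = x.
  by apply: val_inj; rewrite /= /seg clamp_id ?lexx ?ler01// subrr scale0r scale1r add0r.
exists g => x; rewrite /= -[x]sg1.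
have cT : connected [set: R] by apply/connected_intervalP.
apply: (lift_unique covp cT (f := deck g \o s \o sg x) (g := s' \o sg x) (a := 0)) => //.
- apply: continuous_subspaceT => t; apply: continuous_comp; first exact: csg.
  by apply: continuous_comp; exact: cts_fun.
- apply: continuous_subspaceT => t; apply: continuous_comp; first exact: csg.
  exact: cts_fun.
- by move=> t _; rewrite /= pdeck; exact: pss.
- by rewrite /= sg0.
Qed.

End DeckTransformations.

(** * The norm on L^oo(X, mu, Z) *)

Section LinftyNorm.
Context d (X : measurableType d) (R : realType) (mu : probability X R).
Implicit Types (f h : Zfun mu) (a b : Linfty mu).

Definition Lcls f : Linfty mu := \pi_(Quotient.quot (Znull mu))%qT f.

Lemma LclsP a : exists f, a = Lcls f.
Proof. by exists (repr (a : Quotient.quot (Znull mu))); rewrite /Lcls reprK. Qed.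

Lemma Lcls_eqP f h :
  Lcls f = Lcls h <-> {ae mu, forall x, (val f : X -> int) x = val h x}.
Proof.
split=> [/eqP|fh].
  rewrite -Quotient.idealrBE => /asboolP; apply: filterS => x.
  by move=> /eqP; rewrite -[_ == _]/((val f x - val h x : int) == 0) subr_eq0 => /eqP.
apply/eqP; rewrite -Quotient.idealrBE; apply/asboolP.
apply: filterS fh => x fh; apply/eqP.
by rewrite -[_ == _]/((val f x - val h x : int) == 0) subr_eq0 fh.
Qed.

Lemma LclsD f h : Lcls (f + h) = Lcls f + Lcls h.
Proof. exact: raddfD. Qed.

Lemma LclsB f h : Lcls (f - h) = Lcls f - Lcls h.
Proof. exact: raddfB. Qed.

Lemma Zfun_preimage f A : measurable ((val f : X -> int) @^-1` A).
Proof. by have /asboolP[mf _] := valP f. Qed.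

Lemma measurable_Zfun_norm f :
  measurable_fun setT
    ((fun x => (`|(val f : X -> int) x|%:~R)%:E) : X -> \bar R).
Proof.
move=> _ B mB; rewrite setTI.
exact: (Zfun_preimage f [set z | B (`|z|%:~R : R)%:E]).
Qed.

Lemma Linfty_norm_cls f :
  Linfty_norm (Lcls f) = (\int[mu]_x (`|(val f : X -> int) x|%:~R)%:E)%E.
Proof.
rewrite /Linfty_norm; set h := repr _.
apply: ge0_ae_eq_integral => //.
- exact: (measurable_Zfun_norm h).
- exact: (measurable_Zfun_norm f).
- have : Lcls h = Lcls f by rewrite /Lcls reprK.
  move=> /Lcls_eqP[N [mN N0 hf]]; exists N; split=> // x /= nx.
  by apply: hf => hfx; apply: nx => _; rewrite hfx.
Qed.

Lemma Linfty_norm0 : Linfty_norm (0 : Linfty mu) = 0%E.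
Proof.
have -> : 0 = Lcls 0 by rewrite /Lcls raddf0.
by rewrite Linfty_norm_cls; apply: integral0_eq => x _; rewrite normr0.
Qed.

Lemma Linfty_normN a : Linfty_norm (- a) = Linfty_norm a.
Proof.
have [f ->] := LclsP a; have -> : - Lcls f = Lcls (- f) by rewrite /Lcls raddfN.
rewrite !Linfty_norm_cls; apply: eq_integral => x _.
by rewrite -[X in `|X|%:~R%:E]/(- (val f x : int)) normrN.
Qed.

Lemma Linfty_normD a b :
  (Linfty_norm (a + b)%R <= Linfty_norm a + Linfty_norm b)%E.
Proof.
have [f ->] := LclsP a; have [h ->] := LclsP b.
rewrite -LclsD !Linfty_norm_cls.
rewrite -ge0_integralD//.
- apply: ge0_le_integral => //.
  + exact: (measurable_Zfun_norm (f + h)).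
  + by apply: emeasurable_funD; [exact: (measurable_Zfun_norm f)
      |exact: (measurable_Zfun_norm h)].
  + move=> x _; rewrite -EFinD lee_fin -intrD ler_int.
    exact: (ler_normD (val f x : int) (val h x)).
- exact: (measurable_Zfun_norm f).
- exact: (measurable_Zfun_norm h).
Qed.

End LinftyNorm.

Section LinftyNormAct.
Context (R : realType) (G : groupType) (alpha : std_space R G).
Local Notation mu := (sp_measure alpha).

(** Change of variables: the pushforward of [mu] under [g] is [mu]. *)
Lemma Linfty_norm_act (a : Linfty mu) (g : G) :
  Linfty_norm (Linfty_act a g) = Linfty_norm a.
Proof.
have [f ->] := LclsP a; rewrite /Lcls Linfty_actE -!/(Lcls _) !Linfty_norm_cls /=.
pose F z : \bar R := (`|z : int|%:~R)%:E.
transitivity (\int[pushforward mu (sp_act g)]_x F ((val f : alpha -> int) x))%E.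
  rewrite (ge0_integral_pushforward (sp_act_measurable g))//.
    exact: (measurable_Zfun_norm f).
  by move=> x _; rewrite lee_fin ler0z.
apply: eq_measure_integral => [mT A mA|mg A mA _].
  exact: sp_act_measurable.
exact: sp_act_preserving.
Qed.

End LinftyNormAct.

(** * Weak containment and finite partitions *)

Section FinitePartition.
Context d (Y : measurableType d) (R : realType) (nu : probability Y R).
Variables (V : finType) (q : Y -> V).
Hypothesis mq : forall v, measurable (q @^-1` [set v]).

Lemma measurable_fin_preimage (A : set V) : measurable (q @^-1` A).
Proof.
rewrite (_ : _ @^-1` _ = \bigcup_(v in A) q @^-1` [set v]).
  by apply: fin_bigcup_measurable => // v _; exact: mq.
by apply/seteqP; split=> [y Ay|y [v Av qv]]; [exists (q y)|rewrite /preimage /= qv].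
Qed.

Lemma integral_fin_comp (H : V -> R) : (forall v, 0 <= H v) ->
  (\int[nu]_y (H (q y))%:E = \sum_v (H v)%:E * nu (q @^-1` [set v]))%E.
Proof.
move=> H0.
transitivity (\int[nu]_y \sum_v (H v * \1_(q @^-1` [set v]) y)%:E)%E.
  apply: eq_integral => y _; rewrite (bigD1 (q y)) //= indicE mem_set// mulr1.
  rewrite big1 ?adde0// => v /eqP vq; rewrite indicE memNset ?mulr0// => /= qv.
  exact: vq.
rewrite ge0_integral_sum//=.
- apply: eq_bigr => v _; rewrite (integralZl_indic _ (fun=> q @^-1` [set v]))//.
  + by rewrite integral_indic// setIT.
  + by rewrite ltNge H0.
- move=> v; apply/measurable_EFinP; exact: measurable_funM.
- by move=> v y _; rewrite lee_fin mulr_ge0.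
Qed.

Lemma fin_preimage_prob (A : {set V}) :
  fine (nu (q @^-1` [set` A])) = \sum_(v in A) fine (nu (q @^-1` [set v])).
Proof.
have := @integral_fin_comp (fun v => (v \in A)%:R) (fun=> ler0n _ _).
rewrite (_ : (fun y => _) = fun y => (\1_(q @^-1` [set` A]) y)%:E); last first.
  by apply/funext => y; rewrite indicE mem_setE.
rewrite integral_indic//; last exact: measurable_fin_preimage.
rewrite setIT => ->; rewrite -sum_fine => [|v _]; last first.
  by rewrite fin_numM// fin_num_measure.
rewrite [RHS]big_mkcond; apply: eq_bigr => v _; case: ifP => _.
  by rewrite mul1e.
by rewrite mul0e.
Qed.

Lemma fin_prob_total : \sum_v fine (nu (q @^-1` [set v])) = 1.
Proof.
transitivity (fine (nu (q @^-1` [set` [set: V]%SET]))).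
  by rewrite fin_preimage_prob; apply: eq_bigl => v; rewrite inE.
rewrite (_ : _ @^-1` _ = setT) ?probability_setT//.
by apply/seteqP; split=> // y _ /=; rewrite inE.
Qed.

Lemma fin_prob_ge0 v : 0 <= fine (nu (q @^-1` [set v])).
Proof. exact/fine_ge0/measure_ge0. Qed.

End FinitePartition.

Section Subsets.
Context d (Y : measurableType d) (R : realType) (nu : probability Y R).

Lemma measurable_membership (V : finType) (B : V -> set Y) (a : {set V}) :
  (forall v, measurable (B v)) ->
  measurable ((fun y => [set v | y \in B v]%SET) @^-1` [set a]).
Proof.
move=> mB.
rewrite (_ : _ @^-1` _ = \bigcap_(v in [set: V])
    (if v \in a then B v else ~` B v)).
  apply: fin_bigcap_measurable => // v _.
  by case: ifP => // _; exact: measurableC.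
apply/seteqP; split=> [y /= <- v _|y sy].
  by rewrite inE; case: ifPn => [/set_mem//|/negP yv yBv]; apply/yv/mem_set.
apply/setP => v; rewrite inE; have := sy v I.
by case: ifPn => va; [move=> /mem_set|move=> nB; apply/negP => /set_mem].
Qed.

(* integrates [1_{#s <> 1} + #s <= 1 + #s (#s - 1)], where [s] is the set of
   the [v] such that [B v] contains the given point *)
Lemma bonferroni_partition (V : finType) (B : V -> set Y) :
  (forall v, measurable (B v)) -> let s y := [set v | y \in B v]%SET in
  measurable [set y | #|s y| != 1%N] /\
  fine (nu [set y | #|s y| != 1%N]) + \sum_v fine (nu (B v)) <=
  1 + \sum_v \sum_(w | w != v) fine (nu (B v `&` B w)).
Proof.
move=> mB s.
have ms (a : {set V}) := measurable_membership a mB.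
pose P a := fine (nu (s @^-1` [set a])).
have BE v : fine (nu (B v)) = \sum_(a : {set V} | v \in a) P a.
  rewrite (_ : B v = s @^-1` [set` [set a : {set V} | v \in a]%SET]).
    by rewrite fin_preimage_prob//; apply: eq_bigl => a; rewrite inE.
  by apply/seteqP; split=> y /=; rewrite !inE.
have BBE v w : fine (nu (B v `&` B w)) = \sum_(a : {set V} | (v \in a) && (w \in a)) P a.
  rewrite (_ : B v `&` B w = s @^-1` [set` [set a : {set V} | (v \in a) && (w \in a)]%SET]).
    by rewrite fin_preimage_prob//; apply: eq_bigl => a; rewrite inE.
  apply/seteqP; split=> y /=; rewrite !inE.
    by move=> [yv yw]; rewrite !mem_set.
  by move=> /andP[/set_mem ? /set_mem].
have LE : [set y | #|s y| != 1%N] = s @^-1` [set` [set a : {set V} | #|a| != 1%N]%SET].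
  by apply/seteqP; split=> y /=; rewrite inE.
split; first by rewrite LE; exact: measurable_fin_preimage.
rewrite LE fin_preimage_prob// -(fin_prob_total nu ms).
have -> : \sum_v fine (nu (B v)) = \sum_a P a *+ #|a|.
  under eq_bigr do rewrite BE.
  rewrite (exchange_big_dep xpredT) //=; apply: eq_bigr => a _.
  exact: sumr_const.
(* A set of size k contains k (k - 1) ordered pairs of distinct elements. *)
have -> : \sum_v \sum_(w | w != v) fine (nu (B v `&` B w)) =
    \sum_a P a *+ (#|a| * #|a|.-1).
  under eq_bigr do under eq_bigr do rewrite BBE.
  under eq_bigr do rewrite (exchange_big_dep xpredT) //=.
  rewrite exchange_big /=; apply: eq_bigr => a _.
  rewrite mulnC mulrnA -sumr_const [RHS]big_mkcond; apply: eq_bigr => v _.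
  case: ifPn => va; last by rewrite big_pred0// => w; rewrite andbF.
  rewrite (cardsD1 v a) va /= -sumr_const; apply: eq_bigl => w.
  by rewrite !inE.
rewrite big_mkcond -!big_split /=; apply: ler_sum => a _; rewrite inE.
have P0 : 0 <= P a by exact: fin_prob_ge0.
suff : P a *+ ((#|a| != 1%N) + #|a|) <= P a *+ (1 + #|a| * #|a|.-1).
  by rewrite !mulrnDr mulr1n; case: ifP.
apply: ler_wpMn2l => //.
by case: #|a| => [|[|k]] //=; nia.
Qed.


End Subsets.

Section WeakContainment.
Variables (R : realType) (G : groupType).

Lemma sp_actK (alpha : std_space R G) (g : G) :
  cancel (@sp_act R G alpha g) (sp_act g^-1%g).
Proof. by move=> x; rewrite -sp_actM mulVg sp_act1. Qed.

Lemma sp_act_imageV (alpha : std_space R G) (g : G) (A : set alpha) :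
  sp_act g^-1%g @` A = sp_act g @^-1` A.
Proof.
apply/seteqP; split=> [_ [x Ax <-]|x Ax].
  by rewrite /preimage /= -sp_actM mulgV sp_act1.
by exists (sp_act g x) => //; rewrite sp_actK.
Qed.

Lemma measurable_sp_act (alpha : std_space R G) (g : G) (A : set alpha) :
  measurable A -> measurable (sp_act g @^-1` A).
Proof.
by move=> mA; rewrite -[X in measurable X]setTI; exact: sp_act_measurable.
Qed.

Variables alpha beta : std_space R G.
Local Notation mu := (sp_measure alpha).
Local Notation nu := (sp_measure beta).
Hypothesis wc : weakly_contained alpha beta.

(** Weak containment turns the fibres of [q] into sets [B v] that need not form a partition.
    Comparing their pairwise intersections shows that most points lie in exactly one [B v]; there
    [psi] returns that index, and the exceptional set [L] only adds a small error. *)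
Lemma weakly_contained_partition (V : finType) (v0 : V) (q : alpha -> V)
    (F : seq G) (eps : R) :
  (forall v, measurable (q @^-1` [set v])) -> 0 < eps ->
  exists psi : beta -> V, (forall v, measurable (psi @^-1` [set v])) /\
    forall g v w, g \in F ->
      fine (nu (psi @^-1` [set v] `&` (psi \o sp_act g) @^-1` [set w])) <=
      fine (mu (q @^-1` [set v] `&` (q \o sp_act g) @^-1` [set w])) + eps.
Proof.
move=> mq eps0; pose m : R := #|V|%:R.
(* One [dl] is for the comparison of measures; twice m dl + m^2 dl is for [L] and its translate, see
   [dlE]. *)
pose dl := eps / (1 + 2 * (m + m * m)).
have m0 : 0 <= m by exact: ler0n.
have den0 : 0 < 1 + 2 * (m + m * m) by nra.
have dl0 : 0 < dl by rewrite divr_gt0.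
have dlE : dl + 2 * (m * dl + m * m * dl) = eps.
  by rewrite /dl; field; rewrite gt_eqF.
pose A (j : 'I_#|V|) := q @^-1` [set enum_val j].
(* Weak containment speaks of images, which are preimages under the inverse; the identity is added
   to control the intersections of [B v] with [B w]. *)
have [B' [mB' wB']] :=
  wc (1%g :: [seq g^-1%g | g <- F]) dl0 (fun j => mq (enum_val j) : measurable (A j)).
pose B v := B' (enum_rank v).
have mB v : measurable (B v) by exact: mB'.
have wB g v w : g \in 1%g :: F ->
    `|fine (mu (q @^-1` [set v] `&` (q \o sp_act g) @^-1` [set w])) -
      fine (nu (B v `&` sp_act g @^-1` B w))| < dl.
  move=> gF; have gF' : g^-1%g \in 1%g :: [seq g^-1%g | g <- F].
    move: gF; rewrite !inE => /orP[/eqP ->|gF]; first by rewrite invg1 eqxx.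
    by rewrite map_f// orbT.
  have := wB' _ (enum_rank w) (enum_rank v) gF'.
  rewrite !sp_act_imageV /A !enum_rankK -/(B v) -/(B w).
  rewrite !(setIC (sp_act g @^-1` _)) -comp_preimage.
  have fA : mu (q @^-1` [set v] `&` (q \o sp_act g) @^-1` [set w]) \is a fin_num.
    apply: fin_num_measure; apply: measurableI => //.
    by rewrite comp_preimage; exact: measurable_sp_act.
  have fB : nu (B v `&` sp_act g @^-1` B w) \is a fin_num.
    by apply: fin_num_measure; apply: measurableI => //; exact: measurable_sp_act.
  by rewrite -[X in (`|X - _|)%E]fineK// -[X in (`|_ - X|)%E]fineK.
have wB1 v w : `|fine (mu (q @^-1` [set v] `&` q @^-1` [set w])) -
      fine (nu (B v `&` B w))| < dl.
  have := wB 1%g v w (mem_head _ _).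
  have -> : sp_act 1 @^-1` B w = B w.
    by apply/seteqP; split=> x; rewrite /preimage /= sp_act1.
  by have -> : q \o sp_act 1 = q by apply/funext => x /=; rewrite sp_act1.
pose s y := [set v | y \in B v]%SET.
have [mL] := bonferroni_partition nu mB.
rewrite -/s; set L := [set y | _] in mL *.
move=> Lle.
(* The [B v] have total mass at least 1 - m dl, and distinct ones overlap in at most [dl], since
   distinct fibres of [q] are disjoint. *)
have {Lle} L_small : fine (nu L) <= m * dl + m * m * dl.
  have h1 : 1 - m * dl <= \sum_v fine (nu (B v)).
    rewrite -(fin_prob_total mu mq).
    have -> : m * dl = \sum_(v : V) dl by rewrite sumr_const mulr_natl.
    rewrite -sumrB; apply: ler_sum => v _.
    by have := wB1 v v; rewrite !setIid ltr_norml => /andP[]; lra.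
  have h2 : \sum_v \sum_(w | w != v) fine (nu (B v `&` B w)) <= m * m * dl.
    have -> : m * m * dl = \sum_(v : V) \sum_(w : V) dl.
      by rewrite !sumr_const -mulrA -[RHS]mulr_natl -[dl *+ _]mulr_natl.
    apply: ler_sum => v _; rewrite big_mkcond; apply: ler_sum => w _.
    case: ifP => [/eqP wv|_]; last exact: ltW.
    have := wB1 v w; rewrite (_ : _ `&` q @^-1` _ = set0); last first.
      by apply/seteqP; split=> // x [/= -> ]; apply: contra_not wv.
    rewrite measure0 /= ltr_norml => /andP[]; lra.
  lra.
(* The default [v0] is taken exactly on [L]. *)
pose psi y := if [pick v | s y == [set v]%SET] is Some v then v else v0.
have psiL y v : psi y = v -> ~ L y -> B v y.
  rewrite /psi /L /= => psiv /negP; rewrite negbK => /cards1P[w sw].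
  move: psiv; case: pickP => [u /eqP su <-|/(_ w)]; last by move=> /eqP []; exact: sw.
  by have : u \in s y; [rewrite su inE|rewrite inE => /set_mem].
have ms (a : {set V}) := measurable_membership a mB.
have mpsi v : measurable (psi @^-1` [set v]).
  exact: (@measurable_fin_preimage _ _ _ s ms
    [set a | (if [pick v | a == [set v]%SET] is Some v then v else v0) = v]).
exists psi; split=> // g v w gF.
have mBB : measurable (B v `&` sp_act g @^-1` B w).
  by apply: measurableI => //; exact: measurable_sp_act.
have mgL := measurable_sp_act g mL.
have sub : psi @^-1` [set v] `&` (psi \o sp_act g) @^-1` [set w] `<=`
    (B v `&` sp_act g @^-1` B w) `|` L `|` sp_act g @^-1` L.
  move=> y [/= yv yw].
  have [Ly|nLy] := pselect (L y); first by left; right.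
  have [Lg|nLg] := pselect (L (sp_act g y)); first by right.
  by left; left; split; exact: psiL.
have := wB g v w; rewrite inE gF orbT => /(_ isT); rewrite ltr_norml => /andP[h _].
have : (nu (psi @^-1` [set v] `&` (psi \o sp_act g) @^-1` [set w]) <=
   nu (B v `&` sp_act g @^-1` B w) + nu L + nu L)%E.
  apply: (le_trans (le_measure _ _ _ sub)); rewrite ?inE.
  - by apply: measurableI => //; rewrite comp_preimage; exact: measurable_sp_act.
  - by apply: measurableU => //; exact: measurableU.
  apply: (le_trans (measureU2 _ _ _)) => //; first exact: measurableU.
  rewrite -[X in (_ <= _ + X)%E](sp_act_preserving g mL) leeD2r//.
  exact: measureU2.
rewrite -[X in (X <= _)%E]fineK; last first.
  apply: fin_num_measure; apply: measurableI => //; rewrite comp_preimage.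
  exact: measurable_sp_act.
rewrite -[X in (_ <= X + _ + _)%E]fineK ?fin_num_measure//.
rewrite -[nu L]fineK ?fin_num_measure// -!EFinD lee_fin.
lra.
Qed.

End WeakContainment.

(** * Elements of L^oo that factor through a finite set *)

Section FiniteValued.
Context d (X : measurableType d) (R : realType) (mu : probability X R).
Variable V : finType.
Implicit Types (q : X -> V) (c : V -> int).

Lemma Zbounded_fin q c : (forall v, measurable (q @^-1` [set v])) ->
  c \o q \in Zbounded mu.
Proof.
move=> mq; apply/asboolP; split=> [A|].
  by rewrite comp_preimage; exact: measurable_fin_preimage.
exists (\sum_v `|c v|); apply/nearW => x /=.
by rewrite (bigD1 (q x)) //= lerDl sumr_ge0.
Qed.

Definition Lfin q (mq : forall v, measurable (q @^-1` [set v])) c : Linfty mu :=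
  Lcls (exist _ (c \o q) (Zbounded_fin c mq)).

Section Lfin.
Variables (q : X -> V) (mq : forall v, measurable (q @^-1` [set v])).

Lemma LfinB c c' : Lfin mq (fun v => c v - c' v) = Lfin mq c - Lfin mq c'.
Proof. by rewrite /Lfin -LclsB; congr Lcls; apply/val_inj/funext. Qed.

Lemma Lfin_cst k : Lfin mq (fun=> k) = Linfty_cst mu k.
Proof. by congr Lcls; apply/val_inj/funext. Qed.

Lemma Linfty_norm_fin c :
  Linfty_norm (Lfin mq c) =
  (\sum_v `|c v|%:~R * fine (mu (q @^-1` [set v])))%:E.
Proof.
rewrite Linfty_norm_cls /= (@integral_fin_comp _ _ _ _ _ q mq (fun v => `|c v|%:~R)).
  by rewrite -sumEFin; apply: eq_bigr => v _; rewrite EFinM fineK// fin_num_measure.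
by move=> v; rewrite ler0z.
Qed.

End Lfin.

End FiniteValued.

Lemma eq_Lfin d (X : measurableType d) (R : realType) (mu : probability X R)
    (V V' : finType) (q : X -> V) (mq : forall v, measurable (q @^-1` [set v]))
    (q' : X -> V') (mq' : forall v, measurable (q' @^-1` [set v]))
    (c : V -> int) (c' : V' -> int) :
  c \o q =1 c' \o q' -> Lfin mu mq c = Lfin mu mq' c'.
Proof. by move=> cq; congr Lcls; apply/val_inj/funext. Qed.

(** Each essentially bounded integer function takes finitely many values almost everywhere; the
    finite set is refined, one function at a time, by adjoining its value as a new coordinate. *)
Lemma Linfty_fin_rep d (X : measurableType d) (R : realType)
    (mu : probability X R) (S : seq (Linfty mu)) :
  exists (V : finType) (v0 : V) (q : X -> V)
    (mq : forall v, measurable (q @^-1` [set v])) (c : Linfty mu -> V -> int),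
    forall a, a \in S -> a = Lfin mu mq (c a).
Proof.
elim: S => [|a S [V [v0 [q [mq [c cE]]]]]].
  have mq v : measurable ((fun=> tt : unit) @^-1` [set v] : set X).
    by rewrite preimage_cst; case: ifP.
  by exists unit, tt, (fun=> tt), mq, (fun _ _ => 0).
have [f aE] := LclsP a.
have /asboolP[mf [k fk]] := valP f.
pose m := absz k.
(* The shift by [m] codes the 2m + 1 integers from -m to m. Codes of other integers are meaningless,
   but these values occur only on a null set. *)
pose code (z : int) : 'I_(m + m).+1 := inord (absz (z + m%:Z)).
pose decode (i : 'I_(m + m).+1) : int := (i : nat)%:Z - m%:Z.
have codeK z : `|z| <= k -> decode (code z) = z.
  by move=> zk; rewrite /decode /code inordK /m; lia.
pose q' x := (q x, code ((val f : X -> int) x)).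
have mq' v : measurable (q' @^-1` [set v]).
  rewrite (_ : _ @^-1` _ = q @^-1` [set v.1] `&`
      (val f : X -> int) @^-1` [set z | code z = v.2]).
    exact: measurableI.
  by apply/seteqP; split=> [x <-//|x]; case: v => v i [/= <- <-].
pose c' b (v : V * 'I_(m + m).+1) : int :=
  if b == a then decode v.2 else c b v.1.
exists (V * 'I_(m + m).+1)%type, (v0, ord0), q', mq', c' => b.
rewrite inE; case: (eqVneq b a) => [-> _|ba /= bS].
  rewrite [LHS]aE; apply/Lcls_eqP; apply: filterS fk => x fx.
  by rewrite /= /c' eqxx codeK.
rewrite [LHS]cE//; apply: eq_Lfin => x /=.
by rewrite /c' (negPf ba).
Qed.

(** * Approximate equivariant morphisms between L^oo spaces *)

Section ApproximateMap.
Variables (R : realType) (G : groupType) (alpha beta : std_space R G).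
Local Notation mu := (sp_measure alpha).
Local Notation nu := (sp_measure beta).

(** A function of [q] and the translate by [g] of another one both factor through this map; its
    fibres are the sets compared in [weakly_contained_partition]. *)
Definition pair_act (gam : std_space R G) (V : Type) (q : gam -> V) (g : G) x :=
  (q x, q (sp_act g x)).

Lemma measurable_pair_act (gam : std_space R G) (V : finType) (q : gam -> V) g :
  (forall v, measurable (q @^-1` [set v])) ->
  forall u, measurable (pair_act q g @^-1` [set u]).
Proof.
move=> mq [v w]; rewrite (_ : _ @^-1` _ = q @^-1` [set v] `&` sp_act g @^-1` (q @^-1` [set w])).
  by apply: measurableI => //; exact: measurable_sp_act.
by apply/seteqP; split=> [x [<- <-]|x [/= <- <-]].
Qed.

Lemma Lfin_act (gam : std_space R G) (V : finType) (q : gam -> V) g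
    (mq : forall v, measurable (q @^-1` [set v])) (c : V -> int) :
  Linfty_act (Lfin (sp_measure gam) mq c) g =
  Lfin (sp_measure gam) (measurable_pair_act g mq) (fun u => c u.2).
Proof.
by rewrite /Lfin /Lcls Linfty_actE; congr Lcls; apply/val_inj/funext.
Qed.

Lemma Lfin_pair (gam : std_space R G) (V : finType) (q : gam -> V) g
    (mq : forall v, measurable (q @^-1` [set v])) (c : V -> int) :
  Lfin (sp_measure gam) mq c =
  Lfin (sp_measure gam) (measurable_pair_act g mq) (fun u => c u.1).
Proof. exact: eq_Lfin. Qed.

(** The conditions concern finite data only, since weak containment controls finitely many sets and
    group elements at a time. *)
Definition approx_morphism (S : seq (Linfty mu)) (F : seq G) (K : seq int)
    (eps : R) (phi : Linfty mu -> Linfty nu) : Prop :=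
  [/\ {in S &, forall a b, a + b \in S ->
        (Linfty_norm (phi (a + b) - phi a - phi b)%R <= eps%:E)%E},
      {in S & F, forall a g, Linfty_act a g \in S ->
        (Linfty_norm (phi (Linfty_act a g) - Linfty_act (phi a) g)%R <= eps%:E)%E},
      {in K, forall k, Linfty_cst mu k \in S ->
        (Linfty_norm (phi (Linfty_cst mu k) - Linfty_cst nu k)%R <= eps%:E)%E} &
      {in S, forall a, (Linfty_norm (phi a) <= Linfty_norm a + eps%:E)%E}].

(** The map replaces [q] by [psi]. Each defect is a fixed function on [V * V] composed with the pair
    map of [psi]; the same function composed with the pair map of [q] has norm 0 for the first three
    conditions, and the norm of [a] for the last. *)
Lemma weakly_contained_approx_morphism (S : seq (Linfty mu)) (F : seq G)
    (K : seq int) (eps : R) : weakly_contained alpha beta -> 0 < eps ->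
  exists phi, approx_morphism S F K eps phi.
Proof.
move=> wc eps0; have [V [v0 [q [mq [c cE]]]]] := Linfty_fin_rep S.
pose H1 a b := [ffun u : V * V => c (a + b) u.1 - c a u.1 - c b u.1].
(* Here [b] stands for the translate of [a] by some [g]; the formula does not mention [g], so all
   pairs from [S] are listed. *)
pose H2 a b := [ffun u : V * V => c b u.1 - c a u.2].
pose H3 k := [ffun u : V * V => c (Linfty_cst mu k) u.1 - k].
pose H4 a := [ffun u : V * V => c a u.1].
pose Hs : seq {ffun V * V -> int} :=
  [seq H1 a b | a <- S, b <- S] ++ [seq H2 a b | a <- S, b <- S] ++
  [seq H3 k | k <- K] ++ [seq H4 a | a <- S].
pose wt (H : {ffun V * V -> int}) : R := \sum_u `|H u|%:~R.
have wt0 H : 0 <= wt H by apply: sumr_ge0 => u _; rewrite ler0z.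
(* The tolerance per fibre is divided by the total weight of all defects; adding 1 keeps the
   denominator positive. *)
pose dl := eps / (1 + \sum_(H <- Hs) wt H).
have den0 : 0 < 1 + \sum_(H <- Hs) wt H.
  by rewrite ltr_pwDl// sumr_ge0.
have dl0 : 0 < dl by rewrite divr_gt0.
have wtdl H : H \in Hs -> wt H * dl <= eps.
  move=> HHs; rewrite /dl mulrA ler_pdivrMr// mulrC ler_pM2l//.
  rewrite (perm_big _ (perm_to_rem HHs)) /= big_cons addrCA lerDl.
  by rewrite addr_ge0// sumr_ge0.
(* The identity is included for the defects that involve no translation. *)
have [psi [mpsi psiE]] := weakly_contained_partition wc v0 (1%g :: F) mq dl0.
have key g (H : {ffun V * V -> int}) : g \in 1%g :: F -> H \in Hs ->
    (Linfty_norm (Lfin nu (measurable_pair_act g mpsi) H) <=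
     Linfty_norm (Lfin mu (measurable_pair_act g mq) H) + eps%:E)%E.
  move=> gF HHs; rewrite !Linfty_norm_fin -EFinD lee_fin.
  apply: le_trans (_ : _ <= \sum_u `|H u|%:~R *
     (fine (mu (pair_act q g @^-1` [set u])) + dl)) _.
    apply: ler_sum => -[v w] _; rewrite ler_wpM2l ?ler0z//.
    have := psiE g v w gF.
    congr (fine (nu _) <= fine (mu _) + _).
      by apply/seteqP; split=> [x [<- <-]|x [/= <- <-]].
    by apply/seteqP; split=> [x [<- <-]|x [/= <- <-]].
  under eq_bigr do rewrite mulrDr.
  by rewrite big_split /= lerD2l -mulr_suml; exact: wtdl.
have g1 : 1%g \in 1%g :: F by exact: mem_head.
exists (fun a => Lfin nu mpsi (c a)); split.
- move=> a b aS bS abS.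
  have HH : H1 a b \in Hs by rewrite mem_cat; apply/orP; left; exact: allpairs_f.
  have := key _ _ g1 HH.
  (* Stated over any space, to be read over alpha, where the right-hand side vanishes, and over
     beta, where it is the defect. *)
  have E (gam : std_space R G) (r : gam -> V) (mr : forall v, measurable (r @^-1` [set v])) :
     Lfin (sp_measure gam) (measurable_pair_act 1%g mr) (H1 a b) =
     Lfin (sp_measure gam) mr (c (a + b)) - Lfin (sp_measure gam) mr (c a) -
     Lfin (sp_measure gam) mr (c b).
    by rewrite -!LfinB; apply: eq_Lfin => x /=; rewrite ffunE.
  have ab0 : a + b - a - b = 0 by rewrite -addrA -opprD subrr.
  by rewrite !E -!cE// ab0 Linfty_norm0 add0e.
- move=> a g aS gF agS.
  have HH : H2 a (Linfty_act a g) \in Hs.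
    by rewrite !mem_cat; apply/orP; right; apply/orP; left; exact: allpairs_f.
  have := key g _ _ HH; rewrite inE gF orbT => /(_ isT).
  have E (gam : std_space R G) (r : gam -> V) (mr : forall v, measurable (r @^-1` [set v])) :
     Lfin (sp_measure gam) (measurable_pair_act g mr) (H2 a (Linfty_act a g)) =
     Lfin (sp_measure gam) mr (c (Linfty_act a g)) - Linfty_act (Lfin (sp_measure gam) mr (c a)) g.
    rewrite Lfin_act (Lfin_pair g mr) -LfinB.
    by apply: eq_Lfin => x /=; rewrite ffunE.
  by rewrite !E -!cE// subrr Linfty_norm0 add0e.
- move=> k kK kS.
  have HH : H3 k \in Hs.
    by rewrite !mem_cat; apply/orP; right; apply/orP; right; apply/orP; left; exact: map_f.
  have := key _ _ g1 HH.
  have E (gam : std_space R G) (r : gam -> V) (mr : forall v, measurable (r @^-1` [set v])) :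
     Lfin (sp_measure gam) (measurable_pair_act 1%g mr) (H3 k) =
     Lfin (sp_measure gam) mr (c (Linfty_cst mu k)) - Linfty_cst (sp_measure gam) k.
    by rewrite -(Lfin_cst _ mr) -LfinB; apply: eq_Lfin => x /=; rewrite ffunE.
  by rewrite !E -!cE// subrr Linfty_norm0 add0e.
- move=> a aS.
  have HH : H4 a \in Hs.
    by rewrite !mem_cat; apply/orP; right; apply/orP; right; apply/orP; right; exact: map_f.
  have := key _ _ g1 HH.
  have E (gam : std_space R G) (r : gam -> V) (mr : forall v, measurable (r @^-1` [set v])) :
     Lfin (sp_measure gam) (measurable_pair_act 1%g mr) (H4 a) =
     Lfin (sp_measure gam) mr (c a).
    by apply: eq_Lfin => x /=; rewrite ffunE.
  by rewrite !E -!cE.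
Qed.

End ApproximateMap.

(** * Parametrized chains of small norm *)

Lemma freeg_zmod_ind (K : choiceType) (P : {freeg K / int} -> Prop) :
  P 0 -> (forall D E, P D -> P E -> P (D - E)) -> (forall x, P << x >>) ->
  forall D, P D.
Proof.
move=> P0 PB PU D.
have PN E : P E -> P (- E) by move=> PE; rewrite -sub0r; exact: PB.
have PD E F : P E -> P F -> P (E + F).
  by move=> PE PF; rewrite -[F]opprK; apply: PB => //; exact: PN.
rewrite -[D]freeg_sumE; apply: big_ind => // x _.
rewrite -[coeff x D]intz -freegU_mulz.
have Pn n : P (<< x >> *+ n) by elim: n => [|n IH]; rewrite ?mulr0n// mulrS; exact: PD.
by case: (coeff x D) => n; [exact: Pn|rewrite NegzE mulrNz; exact/PN/Pn].
Qed.

Section TensorZmod.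
Context (G : Type) (A C : zmodType) (ra : A -> G -> A) (la : G -> C -> C).

Lemma tens0l c : tens ra la 0 c = 0.
Proof. by apply: (addrI (tens ra la 0 c)); rewrite -tensDl !addr0. Qed.

Lemma tens0r a : tens ra la a 0 = 0.
Proof. by apply: (addrI (tens ra la a 0)); rewrite -tensDr !addr0. Qed.

Lemma tensBl a a' c : tens ra la (a - a') c = tens ra la a c - tens ra la a' c.
Proof. by apply/eqP; rewrite eq_sym subr_eq -tensDl subrK. Qed.

Lemma tensBr a c c' : tens ra la a (c - c') = tens ra la a c - tens ra la a c'.
Proof. by apply/eqP; rewrite eq_sym subr_eq -tensDr subrK. Qed.

Local Notation fgtens := (fgext (fun ac : A * C => tens ra la ac.1 ac.2)).

Let pi_tensE (X : {freeg (A * C)%type / int}) :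
  (\pi_(Quotient.quot (tensor_rel ra la)) X)%qT = fgtens X :> tensor ra la.
Proof.
pose h X : tensor ra la := (\pi_(Quotient.quot (tensor_rel ra la)) X)%qT.
have hB D E : h (D - E) = h D - h E by exact: raddfB.
rewrite -/(h X); elim/freeg_zmod_ind: X => [|D E DE EE|[a c]].
- have h0 : h 0 = 0 by have := hB 0 0; rewrite !subrr.
  by rewrite h0 raddf0.
- by rewrite hB fgextB DE EE.
- by rewrite fgextU.
Qed.

Lemma tens_gen (x : tensor ra la) : exists X, x = fgtens X.
Proof.
by exists (repr (x : Quotient.quot (tensor_rel ra la))); rewrite -pi_tensE reprK.
Qed.

(** Vanishing of a tensor is turned back into membership in the subgroup of relations, where
    [transfer_rel] can act. *)
Lemma fgtens_eq0 X : fgtens X = 0 -> X \in tensor_rel ra la.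
Proof.
rewrite -pi_tensE -[X in X \in _]subr0 Quotient.idealrBE => ->.
by apply/eqP; rewrite pi_tensE raddf0.
Qed.

End TensorZmod.

Section ChainNorm.
Variables (R : realType) (Mt : topologicalType) (G : groupType).
Variables (deck : G -> continuousType Mt Mt) (alpha : std_space R G).
Local Notation mu := (sp_measure alpha).
Local Notation "f ⊗ c" := (tens (@Linfty_act R G alpha) (@deck_chain R Mt G deck _) f c)
  (at level 40).

(** The presentation need not be reduced, which makes the bound subadditive by mere
    concatenation. *)
Definition norm_le n (t : param_chain deck alpha n) (r : \bar R) : Prop :=
  exists s : seq (Linfty mu * singular R n Mt),
    t = \sum_(x <- s) x.1 ⊗ << x.2 >> /\ (\sum_(x <- s) Linfty_norm x.1 <= r)%E.

Section Degree.
Variable n : nat.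
Implicit Types t u : param_chain deck alpha n.

Lemma norm_le0 r : (0 <= r)%E -> norm_le (0 : param_chain deck alpha n) r.
Proof. by move=> r0; exists [::]; rewrite !big_nil. Qed.

Lemma norm_leW t r r' : (r <= r')%E -> norm_le t r -> norm_le t r'.
Proof. by move=> rr' [s [ts sr]]; exists s; split=> //; exact: le_trans rr'. Qed.

Lemma norm_leD t u r r' : norm_le t r -> norm_le u r' -> norm_le (t + u) (r + r')%E.
Proof.
move=> [s [-> sr]] [s' [-> sr']]; exists (s ++ s').
by rewrite !big_cat /=; split=> //; exact: leeD.
Qed.

Lemma norm_leN t r : norm_le t r -> norm_le (- t) r.
Proof.
move=> [s [-> sr]]; exists [seq (- x.1, x.2) | x <- s]; rewrite !big_map /=.
split; last by under eq_bigr do rewrite Linfty_normN.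
rewrite -sumrN; apply: eq_bigr => x _.
by rewrite -[- x.1]sub0r tensBl tens0l sub0r.
Qed.

Lemma norm_leB t u r r' : norm_le t r -> norm_le u r' -> norm_le (t - u) (r + r')%E.
Proof. by move=> tr ur'; apply: norm_leD => //; exact: norm_leN. Qed.

Lemma norm_leB_half t u (e : R) : norm_le t (e / 2)%:E -> norm_le u (e / 2)%:E ->
  norm_le (t - u) e%:E.
Proof. by move=> te ue; rewrite [e]splitr EFinD; exact: norm_leB. Qed.

Lemma norm_le_tensU f (s : singular R n Mt) : norm_le (f ⊗ << s >>) (Linfty_norm f).
Proof. by exists [:: (f, s)]; rewrite !big_seq1. Qed.

(** For fixed [c] the norm is at most a constant times that of [f]; the epsilon-delta form lets the
    induction on [c] halve errors instead of tracking the constant. *)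
Lemma norm_le_tens (c : chain R n Mt) (e : R) : 0 < e ->
  exists2 dl : R, 0 < dl &
    forall f, (Linfty_norm f <= dl%:E)%E -> norm_le (f ⊗ c) e%:E.
Proof.
elim/freeg_zmod_ind: c e => [|c c' IHc IHc'|s] e e0.
- by exists 1 => // f _; rewrite tens0r; apply: norm_le0; rewrite lee_fin ltW.
- have e20 : 0 < e / 2 by rewrite divr_gt0.
  have [dl dl0 cdl] := IHc _ e20; have [dl' dl'0 c'dl'] := IHc' _ e20.
  exists (Num.min dl dl'); first by rewrite lt_min dl0.
  move=> f fdl; rewrite tensBr; apply: norm_leB_half.
    by apply: cdl; apply: le_trans fdl _; rewrite lee_fin ge_min lexx.
  by apply: c'dl'; apply: le_trans fdl _; rewrite lee_fin ge_min lexx orbT.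
- by exists e => // f fe; apply: norm_leW fe _; exact: norm_le_tensU.
Qed.

End Degree.
End ChainNorm.

(** * Passage to reduced forms *)

Section Reduction.
Variables (R : realType) (M Mt : topologicalType) (G : groupType).
Variables (p : continuousType Mt M) (deck : G -> continuousType Mt Mt).
Hypothesis univ : universal_covering R p deck.
Variable alpha : std_space R G.
Local Notation mu := (sp_measure alpha).
Local Notation "f ⊗ c" := (tens (@Linfty_act R G alpha) (@deck_chain R Mt G deck _) f c)
  (at level 40).

Let project n (s : singular R n Mt) : singular R n M := p \o s.

(* two simplices with the same projection differ by a deck transformation,
   which can be moved to the coefficient without changing its norm *)
Lemma reduced_form n (s : seq (Linfty mu * singular R n Mt)) :
  exists s' : seq (Linfty mu * singular R n Mt),
  [/\ uniq [seq project x.2 | x <- s'],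
      \sum_(x <- s) x.1 ⊗ << x.2 >> = \sum_(x <- s') x.1 ⊗ << x.2 >> &
      (\sum_(x <- s') Linfty_norm x.1 <= \sum_(x <- s) Linfty_norm x.1)%E].
Proof.
elim: s => [|[f s0] s [s' [us' ss' ns']]]; first by exists [::].
have [/mapP[[h s1] hs' /= ps]|ns0] :=
    boolP (project s0 \in [seq project x.2 | x <- s']);
  last first.
  exists ((f, s0) :: s'); split; first by rewrite /= ns0.
    by rewrite !big_cons ss'.
  by rewrite !big_cons leeD2l.
have [g gs] : exists g, deck g \o s1 =1 s0.
  apply: (deck_simplex univ) => x.
  exact: (congr1 (fun k : singular R n M => k x) (esym ps)).
case/splitPr: hs' us' ss' ns' => a b us' ss' ns'.
(* As [s0] is the translate of [s1] by [g], balancing moves [g] to the coefficient, and the new term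
   merges with that of [s1]. *)
exists (a ++ (h + Linfty_act f g, s1) :: b); split.
- by move: us'; rewrite !map_cat.
- rewrite big_cons ss' !big_cat /= !big_cons /= tensDl tens_bal.
  rewrite /deck_chain pushU.
  have -> : (deck g \o s1 : singular R n Mt) = s0 by exact/continuousEP.
  by rewrite [LHS]addrCA [X in _ + X]addrA [X in _ + (X + _)]addrC.
- rewrite big_cons /= (le_trans _ (leeD2l _ ns'))// !big_cat /= !big_cons /=.
  rewrite [leRHS]addeCA leeD2l// addeA leeD2r//.
  by rewrite -(Linfty_norm_act f g) addeC; exact: Linfty_normD.
Qed.

(** Converts a bound from an arbitrary presentation into a value of [param_norm], which admits
    reduced forms only. *)
Lemma param_norm_le n (t : param_chain deck alpha n) r :
  norm_le t r -> exists2 r', param_norm p t r' & (r' <= r)%E.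
Proof.
move=> [s [-> sr]]; have [s' [us' -> ns']] := reduced_form s.
exists (\sum_(x <- s') Linfty_norm x.1)%E; last exact: le_trans sr.
exists (size s'), (fun j => (tnth (in_tuple s') j).1), (fun j => (tnth (in_tuple s') j).2).
split.
- move=> i j /= pij; apply/ord_inj/eqP.
  have x0 : Linfty mu * singular R n Mt := tnth (in_tuple s') i.
  rewrite -(nth_uniq (project x0.2) _ _ us') ?size_map//.
  have nthE (k : 'I_(size s')) : nth x0 s' k = tnth (in_tuple s') k.
    by rewrite (tnth_nth x0).
  by rewrite !(nth_map x0)// !nthE; apply/eqP.
- by rewrite big_tnth.
- by rewrite big_tnth.
Qed.

End Reduction.

Section ParamChainMaps.
Variables (R : realType) (Mt : topologicalType) (G : groupType).
Variables (deck : G -> continuousType Mt Mt) (alpha : std_space R G).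
Local Notation mu := (sp_measure alpha).

Lemma coinv_inclB n : {morph @coinv_incl R Mt G deck alpha n : x y / x - y}.
Proof.
apply: textB => [a a' c'|a c' c''|a g c'].
- by rewrite Linfty_cstD tensDl.
- exact: tensDr.
- by rewrite -tens_bal Linfty_act_cst.
Qed.

Lemma param_boundaryB n : {morph @param_boundary R Mt G deck alpha n : x y / x - y}.
Proof.
apply: textB => [a a' c'|a c' c''|a g c']; first exact: tensDl.
- by rewrite raddfD tensDr.
- by rewrite tens_bal /deck_chain boundary_push.
Qed.

End ParamChainMaps.

(** * Transfer of chains along approximate morphisms *)

Section Transfer.
Variables (R : realType) (Mt : topologicalType) (G : groupType).
Variables (deck : G -> continuousType Mt Mt) (alpha beta : std_space R G).
Local Notation mu := (sp_measure alpha).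
Local Notation nu := (sp_measure beta).
Local Notation "f ⊗ c" := (tens (@Linfty_act R G beta) (@deck_chain R Mt G deck _) f c)
  (at level 40).

(* [Q] holds for all maps from [Linfty mu] to [Linfty nu] that are close enough
   to being equivariant morphisms *)
Definition ev_approx (Q : (Linfty mu -> Linfty nu) -> Prop) : Prop :=
  exists S F K (e : R), 0 < e /\ forall phi, approx_morphism S F K e phi -> Q phi.

Lemma ev_approx_mono (Q Q' : (Linfty mu -> Linfty nu) -> Prop) :
  (forall phi, Q phi -> Q' phi) -> ev_approx Q -> ev_approx Q'.
Proof.
move=> QQ' [S [F [K [e [e0 SQ]]]]]; exists S, F, K, e; split=> // phi /SQ.
exact: QQ'.
Qed.

Lemma ev_approxT (Q : (Linfty mu -> Linfty nu) -> Prop) :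
  (forall phi, Q phi) -> ev_approx Q.
Proof. by move=> allQ; exists [::], [::], [::], 1. Qed.

(** The finite data are united and the smaller tolerance is taken. *)
Lemma ev_approxI (Q Q' : (Linfty mu -> Linfty nu) -> Prop) :
  ev_approx Q -> ev_approx Q' -> ev_approx (fun phi => Q phi /\ Q' phi).
Proof.
move=> [S [F [K [e [e0 SQ]]]]] [S' [F' [K' [e' [e'0 SQ']]]]].
exists (S ++ S'), (F ++ F'), (K ++ K'), (Num.min e e').
split; first by rewrite lt_min e0.
move=> phi [phiD phiA phiC phiN].
have mine x : (x <= (Num.min e e')%:E -> x <= e%:E)%E.
  by move=> /le_trans; apply; rewrite lee_fin ge_min lexx.
have mine' x : (x <= (Num.min e e')%:E -> x <= e'%:E)%E.
  by move=> /le_trans; apply; rewrite lee_fin ge_min lexx orbT.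
split; [apply: SQ|apply: SQ'].
- split=> [a b aS bS abS|a g aS gF agS|k kK kS|a aS].
  + by apply/mine/phiD; rewrite mem_cat ?aS ?bS ?abS.
  + by apply/mine/phiA; rewrite mem_cat ?aS ?gF ?agS.
  + by apply/mine/phiC; rewrite mem_cat ?kK ?kS.
  + apply: le_trans (phiN a _) _; first by rewrite mem_cat aS.
    by rewrite leeD2l// lee_fin ge_min lexx.
- split=> [a b aS bS abS|a g aS gF agS|k kK kS|a aS].
  + by apply/mine'/phiD; rewrite mem_cat ?aS ?bS ?abS orbT.
  + by apply/mine'/phiA; rewrite mem_cat ?aS ?gF ?agS orbT.
  + by apply/mine'/phiC; rewrite mem_cat ?kK ?kS orbT.
  + apply: le_trans (phiN a _) _; first by rewrite mem_cat aS orbT.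
    by rewrite leeD2l// lee_fin ge_min lexx orbT.
Qed.

Lemma ev_approx_exists Q : weakly_contained alpha beta -> ev_approx Q ->
  exists phi, Q phi.
Proof.
move=> wc [S [F [K [e [e0 SQ]]]]].
by have [phi /SQ] := weakly_contained_approx_morphism S F K wc e0; exists phi.
Qed.

Lemma ev_approx_norm_le_all (k : nat) (f : 'I_k -> Linfty mu) (e : R) : 0 < e ->
  ev_approx (fun phi =>
    forall j, (Linfty_norm (phi (f j)) <= Linfty_norm (f j) + e%:E)%E).
Proof.
move=> e0; exists [seq f j | j : 'I_k], [::], [::], e; split=> // phi [_ _ _ N] j.
by apply: N; exact: codom_f.
Qed.

(** It lives on the free abelian group because [phi], being neither additive nor equivariant, need
    not descend to the tensor product. *)
Definition transfer n (phi : Linfty mu -> Linfty nu)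
    (x : {freeg (Linfty mu * chain R n Mt)%type / int}) : param_chain deck beta n :=
  fgext (fun ac => phi ac.1 ⊗ ac.2) x.

Lemma transferB n phi : {morph @transfer n phi : x y / x - y}.
Proof. by move=> x y; exact: fgextB. Qed.

(** The elements whose transfer is eventually small form a subgroup, as errors can be halved. It
    contains the generating relations: additivity in the chain holds exactly, the other two up to
    the defects of [phi]. *)
Lemma transfer_rel n (x : {freeg (Linfty mu * chain R n Mt)%type / int}) :
  x \in tensor_rel (@Linfty_act R G alpha) (@deck_chain R Mt G deck n) ->
  forall e : R, 0 < e -> ev_approx (fun phi => norm_le (transfer phi x) e%:E).
Proof.
pose P : {pred {freeg (Linfty mu * chain R n Mt)%type / int}} := fun x =>
  `[< forall e : R, 0 < e -> ev_approx (fun phi => norm_le (transfer phi x) e%:E) >].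
move=> /asboolP xrel; suff /asboolP : x \in P by [].
apply: xrel.
  split.
    apply/asboolP => e e0; apply: ev_approxT => phi.
    by rewrite /transfer raddf0; apply: norm_le0; rewrite lee_fin ltW.
  move=> y z /asboolP yP /asboolP zP; apply/asboolP => e e0.
  have e20 : 0 < e / 2 by rewrite divr_gt0.
  apply: ev_approx_mono (ev_approxI (yP _ e20) (zP _ e20)) => phi [yn zn].
  by rewrite transferB; exact: norm_leB_half.
move=> y [[a [a' [c ->]]]|[a [c [c' ->]]]|[a [g [c ->]]]]; apply/asboolP => e e0.
- have [dl dl0 cdl] := norm_le_tens deck beta c e0.
  exists [:: a; a'; a + a'], [::], [::], dl; split=> // phi [phiD _ _ _].
  rewrite !transferB /transfer !fgextU /= -!tensBl; apply: cdl.
  by apply: phiD; rewrite !inE eqxx ?orbT.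
- apply: ev_approxT => phi; rewrite !transferB /transfer !fgextU /= -!tensBr.
  rewrite [c + c']addrC addrK subrr tens0r.
  by apply: norm_le0; rewrite lee_fin ltW.
- have [dl dl0 cdl] := norm_le_tens deck beta c e0.
  exists [:: a; Linfty_act a g], [:: g], [::], dl; split=> // phi [_ phiA _ _].
  rewrite transferB /transfer !fgextU /= -tens_bal -tensBl; apply: cdl.
  by apply: phiA; rewrite !inE eqxx ?orbT.
Qed.

(** The boundary touches only the chain factor and [phi] only the coefficient, so they commute
    exactly, whatever [phi] is. *)
Lemma transfer_boundary n phi (E : {freeg (Linfty mu * chain R n.+1 Mt)%type / int}) :
  param_boundary (transfer phi E) =
  transfer phi (fgext (fun ac => << (ac.1, boundary ac.2) >>) E).
Proof.
elim/freeg_zmod_ind: E => [|D E DE EE|[a c]].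
- have := @param_boundaryB _ _ _ deck beta n 0 0; rewrite !subrr => b0.
  by rewrite /transfer raddf0 b0 !raddf0.
- rewrite (fgextB _ D E) (transferB phi D E).
  by rewrite (param_boundaryB (transfer phi D)) DE EE transferB.
- by rewrite /transfer !fgextU /= param_boundaryE.
Qed.

Lemma transfer_cst n phi (T : {freeg (int * chain R n Mt)%type / int}) :
  transfer phi (fgext (fun kc => << (Linfty_cst mu kc.1, kc.2) >>) T) =
  fgext (fun kc => phi (Linfty_cst mu kc.1) ⊗ kc.2) T.
Proof.
elim/freeg_zmod_ind: T => [|D E DE EE|[k c]].
- by rewrite /transfer !raddf0.
- by rewrite !(fgextB _ D E) transferB DE EE.
- by rewrite /transfer !fgextU.
Qed.

Lemma coinv_incl_gen n (T : {freeg (int * chain R n Mt)%type / int}) :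
  coinv_incl beta
    (fgext (fun kc => tens (fun k _ => k) (@deck_chain R Mt G deck n) kc.1 kc.2) T) =
  fgext (fun kc => Linfty_cst nu kc.1 ⊗ kc.2) T.
Proof.
elim/freeg_zmod_ind: T => [|D E DE EE|[k c]].
- have := @coinv_inclB _ _ _ deck beta n 0 0; rewrite !subrr => i0.
  by rewrite !raddf0 i0.
- by rewrite !(fgextB _ D E) coinv_inclB DE EE.
- by rewrite !fgextU coinv_inclE.
Qed.

(** Since [phi] almost fixes constants, the image of an integral chain over alpha is sent close to
    its image over beta. *)
Lemma ev_transfer_cst n (T : {freeg (int * chain R n Mt)%type / int}) (e : R) :
  0 < e -> ev_approx (fun phi =>
    norm_le (transfer phi (fgext (fun kc => << (Linfty_cst mu kc.1, kc.2) >>) T) -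
      coinv_incl beta
        (fgext (fun kc => tens (fun k _ => k) (@deck_chain R Mt G deck n) kc.1 kc.2) T))
      e%:E).
Proof.
elim/freeg_zmod_ind: T e => [|D E IHD IHE|[k c]] e e0.
- apply: ev_approxT => phi; rewrite transfer_cst coinv_incl_gen !raddf0 addr0.
  by apply: norm_le0; rewrite lee_fin ltW.
- have e20 : 0 < e / 2 by rewrite divr_gt0.
  apply: ev_approx_mono (ev_approxI (IHD _ e20) (IHE _ e20)) => phi [Dn En].
  have := norm_leB_half Dn En; rewrite !fgextB transferB coinv_inclB.
  by rewrite !(opprD, opprK) addrACA.
- have [dl dl0 cdl] := norm_le_tens deck beta c e0.
  exists [:: Linfty_cst mu k], [::], [:: k], dl; split=> // phi [_ _ phiC _].
  rewrite transfer_cst coinv_incl_gen !fgextU /= -tensBl; apply: cdl.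
  by apply: phiC; rewrite inE.
Qed.

End Transfer.

(** * Comparison of the parametrized simplicial volumes *)

Theorem theorem1p5 (R : realType) (n : nat) (M Mt : topologicalType)
    (G : groupType) (p : continuousType Mt M) (deck : G -> continuousType Mt Mt)
    (o : M -> chain R n M) (alpha beta : std_space R G) :
  topological_manifold R n M ->
  compact [set: M] ->
  connected [set: M] ->
  orientation o ->
  countable [set: G] ->
  universal_covering R p deck ->
  essentially_free alpha -> non_atomic alpha ->
  essentially_free beta -> non_atomic beta ->
  weakly_contained alpha beta ->
  (param_simplicial_volume p deck beta o <=
   param_simplicial_volume p deck alpha o)%E.
Proof.
move=> _ _ _ _ _ univ _ _ _ _ wc.
apply: le_ereal_inf_tmp => r [c [[t [e [tcyc cte]]] [k [f [s [_ cfs rf]]]]]].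
(* Three errors of size [d] arise: from the tensor relations, from the constants and from the norms
   of the coefficients. *)
apply/lee_addgt0Pr => eps eps0; pose d := eps / 3.
have d0 : 0 < d by rewrite divr_gt0.
have [T tT] := tens_gen t; have [E eE] := tens_gen e.
pose X : {freeg (Linfty (sp_measure alpha) * chain R n Mt)%type / int} :=
  \sum_(j < k) << (f j, << s j >>) >>.
pose T' : {freeg (Linfty (sp_measure alpha) * chain R n Mt)%type / int} :=
  fgext (fun kc => << (Linfty_cst (sp_measure alpha) kc.1, kc.2) >>) T.
pose E' : {freeg (Linfty (sp_measure alpha) * chain R n Mt)%type / int} :=
  fgext (fun ac => << (ac.1, boundary ac.2) >>) E.
(* With [id] for [phi], [transfer] is the projection onto the tensor product over alpha, where [X],
   [T'] and [E'] represent [c], the image of [t] and the boundary of [e]. *)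
have relE : transfer deck id (X - T' - E') = 0 :> param_chain deck alpha n.
  have XE : transfer deck id X = c.
    by rewrite cfs /transfer raddf_sum; apply: eq_bigr => j _; exact: fgextU.
  have TE : transfer deck id T' = coinv_incl alpha t.
    by rewrite tT coinv_incl_gen; exact: transfer_cst.
  have EE : transfer deck id E' = param_boundary e.
    by rewrite eE; exact/esym/(@transfer_boundary R Mt G deck alpha alpha n id).
  by rewrite !transferB XE TE EE cte [coinv_incl alpha t + _]addrC addrK subrr.
have rel : X - T' - E' \in
    tensor_rel (@Linfty_act R G alpha) (@deck_chain R Mt G deck n).
  exact: fgtens_eq0.
(* There are [k] coefficients; the successor avoids division by 0. *)
have dk0 : 0 < d / k.+1%:R by rewrite divr_gt0.
have [phi [phiX [phiT phif]]] := ev_approx_exists wc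
  (ev_approxI (transfer_rel beta rel d0)
    (ev_approxI (ev_transfer_cst deck alpha beta T d0)
      (ev_approx_norm_le_all beta f dk0))).
(* Keeping [t] and transferring only [e] makes [c'] an exact fundamental cycle; only its norm is
   approximate. *)
pose c' : param_chain deck beta n :=
  coinv_incl beta t + param_boundary (transfer deck phi E).
have nc' : norm_le c' (r + eps%:E).
  (* A telescoping identity: the two subtracted terms are the transferred relation and the defect on
     constants, both small. *)
  have cE : c' = transfer deck phi X - transfer deck phi (X - T' - E') -
      (transfer deck phi T' - coinv_incl beta t).
    rewrite /c' transfer_boundary !transferB.
    have subK (V : zmodType) (x y z w : V) : w + z = x - (x - y - z) - (y - w).
      by rewrite !opprB (addrC x) -(addrA z) subrK -addrA (addrC y) subrK addrC.
    exact: subK.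
  have nX : norm_le (transfer deck phi X) (r + d%:E).
    exists [seq (phi (f j), s j) | j <- index_enum 'I_k]; rewrite !big_map /=; split.
      rewrite /transfer raddf_sum; apply: eq_bigr => j _.
      exact: fgextU.
    rewrite rf.
    apply: le_trans (_ : _ <= \sum_(j < k) (Linfty_norm (f j) + (d / k.+1%:R)%:E))%E _.
      by apply: lee_sum => j _; exact: phif.
    rewrite big_split /= leeD2l// sumEFin lee_fin sumr_const card_ord -[_ *+ k]mulr_natr.
    by rewrite mulrAC ler_pdivrMr// ler_pM2l// ler_nat.
  rewrite cE; have -> : eps%:E = (d%:E + d%:E + d%:E)%E.
    by rewrite -!EFinD; congr (_%:E); rewrite /d; field.
  rewrite !addeA; apply: norm_leB; first exact: norm_leB.
  by rewrite tT.
have [r' nr' r'le] := param_norm_le univ nc'.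
apply: le_trans r'le; apply: ereal_inf_lbound; exists c'; split=> //.
by exists t, (transfer deck phi E).
Qed.
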